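(* Suppose that the densities $g_S$ have finite second moments and satisfy, for a constant $c_1$ and all $S'\subset S\subset\{1,\dots,n\}$, $$\log g_S(\theta)-\log g_S(\theta')\le c_1|S|+\tfrac1{64}\|\theta-\theta'\|^2\qquad\forall\,\theta,\theta'\in\mathbb{R}^S,$$ $$\bigl|\log g_S(\theta)-\log g_{S'}(\pi_{S'}\theta)\bigr|\le c_1|S|+\tfrac1{64}\|\pi_{S\setminus S'}\theta\|^2\qquad\forall\,\theta\in\mathbb{R}^S,$$ and that there exist constants $C,m_1>0$ and, for any $S_2\subset\{1,\dots,n\}$, a probability density $\gamma_{S_2}$ on $\mathbb{R}^{S_2}$ such that for any $\theta_2\in\mathbb{R}^{S_2}$ and any $S_1\subset S_2^c$, $$\sup_{\theta_1\in\mathbb{R}^{S_1}}\frac{g_{S_1,S_2}(\theta_1,\theta_2)}{g_{S_1}(\theta_1)}\le C\,m_1^{|S_1|+|S_2|}\,\gamma_{S_2}(\theta_2).$$ (The constants $c_1,C,m_1$ do not depend on $n$.) Suppose that $\pi_n(p)\propto e^{-ap\log(bn/p)}$, $p\in\{0,1,\dots,n\}$ (exponent $0$ for $p=0$), for sufficiently large constants $a\ge1$ and $b>e$ (how large depending only on the densities $g_S$ through these conditions). Then for any $s\in(0,2)$, any $q\in(s,2)$ and any sequence $(p_n)$ such that $p_n/n\to0$ and $$p_n^*=n(p_n/n)^s/\log^{s/2}(n/p_n)$$ is bounded away from $0$, one has, for a sufficiently large constant $M$, as $n\to\infty$, $$\sup_{\theta_0\in m_s[p_n]}P_{n,\theta_0}\,\Pi_n\bigl(\theta:|S_\theta|>Mp_n^*\mid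 X\bigr)\to0,$$ $$\sup_{\theta_0\in m_s[p_n]}P_{n,\theta_0}\,\Pi_n\bigl(\theta:d_q(\theta,\theta_0)>M\mu^*_{n,s,q}\mid X\bigr)\to0,$$ where $\mu^*_{n,s,q}=n\,(p_n/n)^s\log^{(q-s)/2}(n/p_n)$.
   Context: For $\theta\in\mathbb{R}^n$, $P_{n,\theta}$ denotes the $N_n(\theta,I)$ distribution of $X=(X_1,\dots,X_n)$, with Lebesgue density $p_{n,\theta}$, and $P_{n,\theta}T$ denotes the expectation of $T=T(X)$ under it. The support of $\theta$ is $S_\theta=\{i:\theta_i\ne0\}$; $d_q(\theta,\theta')=\sum_{i=1}^n|\theta_i-\theta_i'|^q$ (no $q$th root); $\|\cdot\|$ is the Euclidean norm. Weak $\ell_s$-ball: $m_s[p_n]=\{\theta\in\mathbb{R}^n:\frac1n\max_{1\le i\le n}i\,|\theta_{[i]}|^s\le(p_n/n)^s\}$, where $|\theta_{[1]}|\ge|\theta_{[2]}|\ge\cdots\ge|\theta_{[n]}|$ is the nonincreasing rearrangement of the absolute values of the coordinates of $\theta$. Prior $\Pi_n$ on $\mathbb{R}^n$: (P1) a dimension $p$ is drawn from a probability measure $\pi_n$ on $\{0,1,\dots,n\}$ with $\pi_n(p)>0$ for every $p$; (P2) given $p$, a subset $S\subset\{1,\dots,n\}$ with $|S|=p$ is drawn uniformly from the $\binom np$ subsets of size $p$; (P3) given $(p,S)$, the vector $\theta_S=(\theta_i:i\in S)$ is drawn from a probability density $g_S$ on $\mathbb{R}^S$ (if $p\ge1$),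 and the coordinates $\theta_i$, $i\notin S$, are set equal to $0$. The density $g_S$ depends on $S$ only through $|S|$ (identifying $\mathbb{R}^S$ with $\mathbb{R}^{|S|}$); by convention $g_\emptyset=1$. Posterior: $\Pi_n(B\mid X)=\int_B p_{n,\theta}(X)\,d\Pi_n(\theta)\big/\int p_{n,\theta}(X)\,d\Pi_n(\theta)$ for Borel $B\subset\mathbb{R}^n$. Notation: $\pi_{S'}\theta=(\theta_i:i\in S')$ is coordinate projection onto $\mathbb{R}^{S'}$. For a partition $S=S_1\cup S_2$ into disjoint sets, with the corresponding partition $\theta=(\theta_1,\theta_2)$ of $\theta\in\mathbb{R}^S$, $g_{S_1,S_2}(\theta_1,\theta_2)=g_S(\theta)$. *)

(* Defs.v *)
From HB Require Import structures.
From mathcomp Require Import all_boot all_order all_algebra.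
From mathcomp Require Import all_classical all_reals all_analysis.
From mathcomp Require Import measurable_realfun.

Set Implicit Arguments.
Unset Strict Implicit.
Unset Printing Implicit Defensive.

Import Order.TTheory GRing.Theory Num.Theory.
Import numFieldNormedType.Exports.

Local Open Scope classical_set_scope.
Local Open Scope ring_scope.

(* The space R^n is n.-tuple R with the sigma-algebra
   generated by the coordinates, i.e. its Borel sigma-algebra. *)

Section lebesgue_tuple.
Context {R : realType}.

(* lebesgue_measure is stated on the type measurableTypeR R, whose display
   differs from that of the canonical measurable structure of R; lebesgue1 is
   the same set function on the latter. *)
Definition lebesgue1 : set R -> \bar R := @lebesgue_measure R.

Let l0 : lebesgue1 set0 = 0%E.
Proof. exact: (measure0 (@lebesgue_measure R)). Qed.

Let l_ge0 A : (0 <= lebesgue1 A)%E.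
Proof. exact: (measure_ge0 (@lebesgue_measure R)). Qed.

Let l_sigma_additive : semi_sigma_additive lebesgue1.
Proof. exact: (@measure_semi_sigma_additive _ _ _ (@lebesgue_measure R)). Qed.

HB.instance Definition _ := isMeasure.Build _ _ _ lebesgue1
  l0 l_ge0 l_sigma_additive.

Let l_sigma_finite : sigma_finite setT lebesgue1.
Proof. exact: (sigma_finiteT (@lebesgue_measure R)). Qed.

HB.instance Definition _ := @Measure_isSigmaFinite.Build _ _ _ lebesgue1
  l_sigma_finite.

Lemma ge0_integral_lebesgue1 (f : R -> \bar R) :
  measurable_fun setT f -> (forall x, 0 <= f x)%E ->
  (\int[lebesgue1]_x f x = \int[lebesgue_measure]_x f x)%E.
Proof.
move=> mf f0.
rewrite -[lebesgue1]/(pushforward (@lebesgue_measure R)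
  (idfun : measurableTypeR R -> R)).
by rewrite ge0_integral_pushforward//= => _ B mB; rewrite setTI.
Qed.

Definition tcons n (z : R * n.-tuple R) : n.+1.-tuple R := [tuple of z.1 :: z.2].

Lemma measurable_tcons n : measurable_fun setT (@tcons n).
Proof. exact: measurable_cons. Qed.

Section cons.
Variables (n : nat) (m : {sigma_finite_measure set (n.-tuple R) -> \bar R}).

Definition lebesgue_cons : set (n.+1.-tuple R) -> \bar R :=
  pushforward (lebesgue1 \x m)%E (@tcons n).

Let lc0 : lebesgue_cons set0 = 0%E.
Proof. by rewrite /lebesgue_cons /pushforward preimage_set0 measure0. Qed.

Let lc_ge0 A : (0 <= lebesgue_cons A)%E.
Proof. exact: (measure_ge0 (lebesgue1 \x m)%E). Qed.

Let lc_sigma_additive : semi_sigma_additive lebesgue_cons.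
Proof.
exact: (@measure_semi_sigma_additive _ _ _
  (measure_function_pushforward__canonical__measure_function_Measure
     (lebesgue1 \x m)%E (@measurable_tcons n))).
Qed.

HB.instance Definition _ := isMeasure.Build _ _ _ lebesgue_cons
  lc0 lc_ge0 lc_sigma_additive.

Let lc_sigma_finite : sigma_finite setT lebesgue_cons.
Proof.
have /sigma_finiteP[F [TF ndF Foo]] := sigma_finiteT lebesgue1.
have /sigma_finiteP[G [TG ndG Goo]] := sigma_finiteT m.
pose u (t : n.+1.-tuple R) := (thead t, [tuple of behead t]).
have mu : measurable_fun setT u.
  apply/measurable_fun_pair => /=.
    exact: measurable_tnth.
  exact: measurable_behead.
exists (fun k => u @^-1` (F k `*` G k)).
  apply/esym/seteqP; split=> // t _.
  have [i _ Fi] : (\bigcup_i F i) (u t).1 by rewrite -TF.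
  have [j _ Gj] : (\bigcup_i G i) (u t).2 by rewrite -TG.
  exists (maxn i j) => //; split.
    by move: Fi; apply/subsetPset/ndF/leq_maxl.
  by move: Gj; apply/subsetPset/ndG/leq_maxr.
move=> k; have [[mF Fk] [mG Gk]] := (Foo k, Goo k); split.
  by rewrite -[X in measurable X]setTI; apply: mu => //; exact: measurableX.
rewrite /lebesgue_cons /pushforward (_ : _ @^-1` _ = F k `*` G k).
  by rewrite product_measure1E// lte_mul_pinfty// ge0_fin_numE.
apply/seteqP; split=> -[x t] /=; rewrite /u /tcons /= theadE;
  by rewrite (_ : [tuple of _] = t)//; apply/val_inj.
Qed.

HB.instance Definition _ := @Measure_isSigmaFinite.Build _ _ _ lebesgue_cons
  lc_sigma_finite.

End cons.

(* Lebesgue measure on R^n; the unit mass when n = 0, so that the only density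
   on R^0 is the constant 1. *)
Fixpoint lebesgue_tuple n : {sigma_finite_measure set (n.-tuple R) -> \bar R} :=
  match n with
  | 0 => \d_([tuple] : 0.-tuple R)
  | n.+1 => lebesgue_cons (lebesgue_tuple n)
  end.

End lebesgue_tuple.

Section density.
Context {R : realType}.

Record density n := Density {
  density_fun :> n.-tuple R -> R ;
  measurable_density : measurable_fun setT density_fun ;
  density_ge0 : forall t, 0 <= density_fun t ;
  integral_density : (\int[lebesgue_tuple n]_t (density_fun t)%:E = 1)%E }.

Section density_prob.
Variables (n : nat) (f : density n).

Definition density_prob (A : set (n.-tuple R)) : \bar R :=
  (\int[lebesgue_tuple n]_(t in A) (f t)%:E)%E.

Let dp0 : density_prob set0 = 0%E.
Proof. by rewrite /density_prob integral_set0. Qed.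

Let dp_ge0 A : (0 <= density_prob A)%E.
Proof. by apply: integral_ge0 => t _; rewrite lee_fin density_ge0. Qed.

Let dp_sigma_additive : semi_sigma_additive density_prob.
Proof.
move=> F mF tF mUF; rewrite /density_prob ge0_integral_bigcup//=.
- apply: is_cvg_ereal_nneg_natsum_cond => k _ _.
  by apply: integral_ge0 => t _; rewrite lee_fin density_ge0.
- apply: measurable_funTS.
  by apply/measurable_EFinP; exact: measurable_density.
- by move=> t _; rewrite lee_fin density_ge0.
Qed.

HB.instance Definition _ := isMeasure.Build _ _ _ density_prob
  dp0 dp_ge0 dp_sigma_additive.

Let dpT : density_prob setT = 1%E.
Proof. exact: integral_density. Qed.

HB.instance Definition _ := @Measure_isProbability.Build _ _ R density_prob dpT.

End density_prob.

(* The density of N_n(theta, I) is the product of the densities of the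
   N(theta_i, 1). *)
Section normal_tuple.

Let tnth_thead_behead n (t : n.+1.-tuple R) (i : 'I_n) :
  tnth [tuple of behead t] i = tnth t (lift ord0 i).
Proof. by rewrite [in RHS](tuple_eta t) tnthS. Qed.

Definition normal_tuple_fun n (theta x : n.-tuple R) : R :=
  \prod_(i < n) normal_pdf (tnth theta i) 1 (tnth x i).

Lemma normal_tuple_fun_ge0 n (theta x : n.-tuple R) :
  0 <= normal_tuple_fun theta x.
Proof. by apply: prodr_ge0 => i _; exact: normal_pdf_ge0. Qed.

Lemma measurable_normal_tuple_fun n (theta : n.-tuple R) :
  measurable_fun setT (normal_tuple_fun theta).
Proof.
apply: measurable_prod => i _; apply: measurableT_comp.
  exact: measurable_normal_pdf.
exact: measurable_tnth.
Qed.

Lemma integral_normal_tuple_fun n (theta : n.-tuple R) :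
  (\int[lebesgue_tuple n]_x (normal_tuple_fun theta x)%:E = 1)%E.
Proof.
elim: n theta => [|n IH] theta /=.
  rewrite integral_dirac//=; last first.
    by apply/measurable_EFinP; exact: measurable_normal_tuple_fun.
  by rewrite diracT mul1e /normal_tuple_fun big_ord0.
rewrite /lebesgue_cons ge0_integral_pushforward//=; last 3 first.
- exact: measurable_tcons.
- by apply/measurable_EFinP; exact: measurable_normal_tuple_fun.
- by move=> x _; rewrite lee_fin normal_tuple_fun_ge0.
rewrite fubini_tonelli1//=; last 2 first.
- apply/measurable_EFinP; apply: measurableT_comp.
    exact: measurable_normal_tuple_fun.
  exact: measurable_tcons.
- by move=> x; rewrite lee_fin normal_tuple_fun_ge0.
transitivity (\int[lebesgue1]_x (normal_pdf (tnth theta ord0) 1 x)%:E)%E;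
  last first.
  rewrite ge0_integral_lebesgue1 ?integral_normal_pdf//.
    by apply/measurable_EFinP; exact: measurable_normal_pdf.
  by move=> x; rewrite lee_fin normal_pdf_ge0.
apply: eq_integral => x _; rewrite /fubini_F.
under eq_integral => t _.
  rewrite /normal_tuple_fun big_ord_recl /tcons /= tnth0 EFinM.
  rewrite (_ : \prod_(i < n) _ =
     normal_tuple_fun [tuple of behead theta] t); last first.
    by apply: eq_bigr => i _; rewrite tnthS tnth_thead_behead.
  over.
rewrite (@ge0_integralZl _ _ _ (lebesgue_tuple n) setT _
  (fun t => (normal_tuple_fun [tuple of behead theta] t)%:E)) ?IH ?mule1//.
- by apply/measurable_EFinP; exact: measurable_normal_tuple_fun.
- by move=> t _; rewrite lee_fin normal_tuple_fun_ge0.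
- by rewrite lee_fin normal_pdf_ge0.
Qed.

Definition normal_tuple_pdf n (theta : n.-tuple R) : density n :=
  Density (measurable_normal_tuple_fun theta) (@normal_tuple_fun_ge0 n theta)
    (integral_normal_tuple_fun theta).

End normal_tuple.
End density.
Arguments density R n : clear implicits.

(* A vector of R^S, for S a subset of the index set, is a #|S|.-tuple listing
   its coordinates in the increasing order of their indices. *)
Section coordinates.
Context {R : realType}.
Variable n : nat.
Implicit Types (S : {set 'I_n}) (t theta : n.-tuple R).

(* Completes a vector of R^S with zeros; for i outside S, index i (enum S) is
   the size of t, and nth returns its default value 0. *)
Definition embed S (t : #|S|.-tuple R) : n.-tuple R :=
  [tuple nth 0 t (index i (enum S)) | i < n].

Definition coord_proj S theta : #|S|.-tuple R :=
  [tuple tnth theta (enum_val j) | j < #|S|].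

Lemma tnth_embed S (t : #|S|.-tuple R) (j : 'I_#|S|) :
  tnth (embed t) (enum_val j) = tnth t j.
Proof.
rewrite tnth_mktuple (tnth_nth 0); congr nth.
rewrite (enum_val_nth (enum_val j)) index_uniq ?enum_uniq//.
by rewrite -cardE.
Qed.

Lemma tnth_embed_out S (t : #|S|.-tuple R) i : i \notin S ->
  tnth (embed t) i = 0.
Proof.
move=> iS; rewrite tnth_mktuple nth_default// size_tuple cardE.
by rewrite memNindex// mem_enum.
Qed.

Lemma coord_projK S : cancel (@embed S) (coord_proj S).
Proof. by move=> t; apply: eq_from_tnth => j; rewrite tnth_mktuple tnth_embed. Qed.

Lemma measurable_embed S : measurable_fun setT (@embed S).
Proof.
apply/measurable_fun_tnthP => i.
have [ltiS|geiS] := ltnP (index i (enum S)) #|S|.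
  rewrite (_ : _ \o _ = fun t : #|S|.-tuple R => tnth t (Ordinal ltiS)).
    exact: measurable_tnth.
  by apply/funext => t /=; rewrite tnth_mktuple (tnth_nth 0).
rewrite (_ : _ \o _ = cst 0)//; apply/funext => t /=.
by rewrite tnth_mktuple nth_default// size_tuple.
Qed.

(* For disjoint S1 and S2, the vector of R^(S1 U S2) that restricts to t1 on S1
   and to t2 on S2. *)
Definition merge_coords S1 S2 (t1 : #|S1|.-tuple R) (t2 : #|S2|.-tuple R) :
    #|S1 :|: S2|.-tuple R :=
  coord_proj (S1 :|: S2) [tuple tnth (embed t1) i + tnth (embed t2) i | i < n].

Definition coord_support t : {set 'I_n} := [set i | tnth t i != 0]%SET.

End coordinates.

Section norms.
Context {R : realType}.

Definition tsub n (t u : n.-tuple R) : n.-tuple R :=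
  [tuple tnth t i - tnth u i | i < n].

Definition enorm n (t : n.-tuple R) : R :=
  Num.sqrt (\sum_(i < n) tnth t i ^+ 2).

(* No q-th root is taken. *)
Definition dq (q : R) n (t u : n.-tuple R) : R :=
  \sum_(i < n) `|tnth t i - tnth u i| `^ q.

Definition abs_sorted n (t : n.-tuple R) : seq R :=
  sort >=%R [seq `|x| | x <- t].

(* The index i runs from 0 to n - 1, hence i.+1. *)
Definition weak_ball (s : R) n (pn : R) : set (n.-tuple R) :=
  [set t | n%:R^-1 * \big[Num.max/0]_(i < n) (i.+1%:R * (abs_sorted t)`_i `^ s)
           <= (pn / n%:R) `^ s].
End norms.
Arguments weak_ball {R} s n pn.

Section prior.
Context {R : realType}.

(* The dimension p has probability pi p, then S is uniform among the 'C(n, p)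
   subsets of size p, then the coordinates in S have density g p. *)
Definition prior (pi : nat -> R) (n : nat) (g : forall k, density R k)
    (A : set (n.-tuple R)) : \bar R :=
  (\sum_(S : {set 'I_n}) (pi #|S| / 'C(n, #|S|)%:R)%:E *
     pushforward (density_prob (g #|S|)) (@embed R n S) A)%E.

(* At p = 0 the exponent is 0 because of the factor p%:R. *)
Definition cweight (a b : R) n p : R :=
  expR (- (a * p%:R * ln (b * n%:R / p%:R))).

Definition cdim (a b : R) n p : R :=
  cweight a b n p / \sum_(k < n.+1) cweight a b n k.

Lemma cdim_ge0 a b n p : 0 <= cdim a b n p.
Proof. by rewrite divr_ge0 ?expR_ge0 ?sumr_ge0// => *; exact: expR_ge0. Qed.

Lemma cdim_sum1 a b n : \sum_(p < n.+1) cdim a b n p = 1.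
Proof.
rewrite -mulr_suml divff// gt_eqF//.
rewrite big_ord_recl ltr_pwDl ?expR_gt0 ?sumr_ge0// => *; exact: expR_ge0.
Qed.

Variables (a b : R) (n : nat) (g : forall k, density R k).

Definition complexity_prior : set (n.-tuple R) -> \bar R :=
  prior (cdim a b n) g.

Let cp0 : complexity_prior set0 = 0%E.
Proof.
rewrite /complexity_prior /prior big1// => S _.
by rewrite /pushforward preimage_set0 measure0 mule0.
Qed.

Let cp_ge0 A : (0 <= complexity_prior A)%E.
Proof.
apply: sume_ge0 => S _; rewrite mule_ge0//; last exact: (measure_ge0 (density_prob (g #|S|))).
by rewrite lee_fin divr_ge0 ?cdim_ge0.
Qed.

Let cp_sigma_additive : semi_sigma_additive complexity_prior.
Proof.
move=> F mF tF mUF.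
rewrite [X in X @ _ --> _](_ : _ = fun m =>
  (\sum_(S : {set 'I_n}) \sum_(0 <= k < m)
     (cdim a b n #|S| / 'C(n, #|S|)%:R)%:E *
     pushforward (density_prob (g #|S|)) (@embed R n S) (F k)))%E; last first.
  by apply/funext => m; rewrite exchange_big.
apply: cvg_nnesum => S _.
  apply: nearW => m; apply: sume_ge0 => k _.
  rewrite mule_ge0//; last exact: (measure_ge0 (density_prob (g #|S|))).
  by rewrite lee_fin divr_ge0 ?cdim_ge0.
have c0 : 0 <= cdim a b n #|S| / 'C(n, #|S|)%:R :> R.
  by rewrite divr_ge0 ?cdim_ge0.
exact: (@measure_semi_sigma_additive _ _ _ (mscale (NngNum c0)
  (measure_function_pushforward__canonical__measure_function_Measure
     (density_prob (g #|S|)) (@measurable_embed R n S)))).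
Qed.

HB.instance Definition _ := isMeasure.Build _ _ _ complexity_prior
  cp0 cp_ge0 cp_sigma_additive.

Let cpT : complexity_prior setT = 1%E.
Proof.
rewrite /complexity_prior /prior.
under eq_bigr do rewrite /pushforward preimage_setT probability_setT mule1.
rewrite sumEFin -[in RHS](cdim_sum1 a b n); congr EFin.
pose c (S : {set 'I_n}) : 'I_n.+1 := inord #|S|.
have cE S : c S = #|S| :> nat.
  by rewrite inordK// ltnS -[leqRHS]card_ord max_card.
rewrite (partition_big c xpredT)//=; apply: eq_bigr => p _.
rewrite (eq_bigr (fun=> cdim a b n p / 'C(n, p)%:R)); last first.
  by move=> S /eqP <-; rewrite cE.
rewrite sumr_const (_ : #|_| = 'C(n, p)); last first.
  transitivity #|[set S : {set 'I_n} | #|S| == p]%SET|.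
    by apply: eq_card => S; rewrite [RHS]inE -[in RHS]cE.
  by rewrite card_draws card_ord.
by rewrite -[LHS]mulr_natr divfK// pnatr_eq0 -lt0n bin_gt0 -ltnS.
Qed.

HB.instance Definition _ := @Measure_isProbability.Build _ _ R complexity_prior cpT.

End prior.

Section posterior.
Context {R : realType}.

Definition posterior n (Pi : probability (n.-tuple R) R) (x : n.-tuple R)
    (B : set (n.-tuple R)) : R :=
  fine (\int[Pi]_(theta in B) (normal_tuple_pdf theta x)%:E) /
  fine (\int[Pi]_theta (normal_tuple_pdf theta x)%:E).

Definition pstar (s : R) (p : nat -> R) n : R :=
  n%:R * (p n / n%:R) `^ s / ln (n%:R / p n) `^ (s / 2).

Definition mustar (s q : R) (p : nat -> R) n : R :=
  n%:R * (p n / n%:R) `^ s * ln (n%:R / p n) `^ ((q - s) / 2).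
End posterior.

(* Main.v *)
(* Write k for p_n^* and rho = k log(n/p_n). The evidence of each model S is
   compared, pointwise in x, with the evidence of another model, which is a
   part of the denominator of the posterior; no event of large probability and
   no test is needed. For a truth theta supported in a set S0 with |S0| <= k:
   - if |S| > M k, S is compared with S \cap S0. By the condition on
     g_{S1,S2}/g_{S1} the ratio of the evidences is at most C m1^|S| times a
     likelihood ratio with expectation 1 under theta, and the model weights
     decrease fast enough for the sum over S to be exponentially small;
   - if |S| <= M k, S is compared with T = S \cup S0. The other two conditions
     replace g_T and g_S by g_T(theta) exp(+- |u|^2/64), u the deviation from
     theta, and the Gaussian integrals that remain decay like exp(-|u|^2/16).
   A general theta0 in the weak ball is replaced by its restriction to the
   coordinates larger than sqrt(log(n/p_n)), at most k in number. The remaining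
   coordinates have squared norm of order rho, so that the change of measure
   costs a factor exp(O(rho)), which the bounds above absorb for large M. *)

Require Import Defs.
From HB Require Import structures.
From mathcomp Require Import all_boot all_order all_algebra.
From mathcomp Require Import all_classical all_reals all_analysis.
From mathcomp Require Import measurable_realfun ring lra.

Set Implicit Arguments.
Unset Strict Implicit.
Unset Printing Implicit Defensive.

Import Order.TTheory GRing.Theory Num.Theory.
Import numFieldNormedType.Exports.

Local Open Scope classical_set_scope.
Local Open Scope ring_scope.

(** * Lebesgue measure on tuples *)

Section product_integral.
Context {R : realType}.

(** If N_S p_theta <= K N_T G pointwise, with G of integral at most 1, then N_S/N_T has expectation
    at most K under theta. Both comparisons supply G explicitly. In the first it is a mixture over
    gamma of normal densities shifted on the added coordinates, which requires theta to vanish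
    there; elements of a weak ball may have full support, and this forces the truncation. In the
    second it is a product density, normal with variance 4 on T and standard normal elsewhere. The
    constant 1/64 leaves the quadratic forms in x, theta and t enough room for this. Prior cost and
    distances live on one scale: with L = log(n/p_n), log(n/k) lies between s L and 2 s L, so the
    prior cost of a dimension M k is of order k L, like the squared distances. The resulting bound
    exp(- k L) is uniform over the ball and vanishes because k stays away from 0 while L tends to
    infinity. Squared distance controls d_q since q < 2: errors up to sqrt L are counted, larger
    ones are bounded through their squares. *)

Lemma measurable_prode d (T : measurableType d) (I : Type) (r : seq I)
    (P : pred I) (f : I -> T -> \bar R) :
  (forall i, measurable_fun setT (f i)) ->
  measurable_fun setT (fun x => \prod_(i <- r | P i) f i x)%E.
Proof.
move=> mf; elim: r => [|i r IH].
  by under eq_fun do rewrite big_nil; exact: measurable_cst.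
under eq_fun do rewrite big_cons; case: (P i) => //.
exact: emeasurable_funM.
Qed.

Definition boxes n : set (set (n.-tuple R)) :=
  [set B | exists2 A : 'I_n -> set R, (forall i, measurable (A i)) &
    B = [set t | forall i, A i (tnth t i)]].

Lemma integral_tcons n (F : n.+1.-tuple R -> \bar R) :
  measurable_fun setT F -> (forall t, 0 <= F t)%E ->
  (\int[lebesgue_tuple n.+1]_t F t =
   \int[lebesgue1]_x \int[lebesgue_tuple n]_t F (tcons (x, t)))%E.
Proof.
move=> mF F0; rewrite /= /lebesgue_cons ge0_integral_pushforward//=.
- rewrite fubini_tonelli1//=.
  by apply: measurableT_comp => //; exact: measurable_tcons.
- exact: measurable_tcons.
Qed.

(** Coordinates are split off one at a time by Tonelli. Box measures and the Gaussian integrals over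
    R^S below reduce to this formula. *)
Lemma integral_tuple_prod n (f : 'I_n -> R -> \bar R) :
  (forall i, measurable_fun setT (f i)) -> (forall i x, 0 <= f i x)%E ->
  (\int[lebesgue_tuple n]_t \prod_(i < n) f i (tnth t i) =
   \prod_(i < n) \int[lebesgue1]_x f i x)%E.
Proof.
have mp k (g : 'I_k -> R -> \bar R) : (forall i, measurable_fun setT (g i)) ->
    measurable_fun setT (fun t : k.-tuple R => \prod_(i < k) g i (tnth t i))%E.
  move=> mg; apply: measurable_prode => i; apply: measurableT_comp => //.
  exact: measurable_tnth.
elim: n f => [|n IH] f mf f0.
  rewrite big_ord0 /= integral_dirac//=; last exact: mp.
  by rewrite diracT mul1e big_ord0.
rewrite integral_tcons; last 2 first.
- exact: mp.
- by move=> t; apply: prode_ge0.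
rewrite big_ord_recl -ge0_integralZr//=; last first.
  by apply: prode_ge0 => i _; exact: integral_ge0.
apply: eq_integral => x _.
pose g (t : n.-tuple R) := (\prod_(i < n) f (lift ord0 i) (tnth t i))%E.
rewrite -(IH (fun i => f (lift ord0 i)))//.
rewrite -(@ge0_integralZl _ _ _ (lebesgue_tuple n) setT _ g)//.
- apply: eq_integral => t _; rewrite big_ord_recl /= tnth0; congr mule.
  by apply: eq_bigr => i _; rewrite tnthS.
- exact: (mp _ (fun i => f (lift ord0 i))).
- by move=> t _; exact: prode_ge0.
Qed.

Lemma setI_closed_boxes n : setI_closed (@boxes n).
Proof.
move=> _ _ [A mA ->] [B mB ->]; exists (fun i => A i `&` B i).
  by move=> i; exact: measurableI.
apply/seteqP; split => [t [tA tB] i|t tAB]; first by split; [exact: tA|exact: tB].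
by split=> i; have [] := tAB i.
Qed.

Lemma measurable_boxes n : @measurable _ (n.-tuple R) = <<s @boxes n >>.
Proof.
apply/seteqP; split.
  apply: smallest_sub; first exact: smallest_sigma_algebra.
  case: n => [|n]; first by rewrite big_ord0; exact: sub0set.
  rewrite -bigcup_mkord_ord => C [i /= ltin] [A mA <-]; rewrite setTI.
  apply: sub_sigma_algebra.
  exists (fun j => if j == inord i then A else setT).
    by move=> j; case: ifP.
  apply/seteqP; split => [t At j /=|t /(_ (inord i))/=].
    by case: eqP => // ->.
  by rewrite eqxx.
apply: smallest_sub; first exact: sigma_algebra_measurable.
move=> _ [A mA ->].
rewrite (_ : mkset _ =
    \big[setI/setT]_(i < n) ((fun t : n.-tuple R => tnth t i) @^-1` A i)).
  apply: bigsetI_measurable => i _; rewrite -[X in measurable X]setTI.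
  exact: measurable_tnth.
rewrite -bigcap_seq; apply/seteqP; split => t /= tA i; first by move=> _; exact: tA.
by have := tA i; apply; rewrite /= mem_index_enum.
Qed.

Lemma lebesgue_tuple_box n (A : 'I_n -> set R) :
  (forall i, measurable (A i)) ->
  lebesgue_tuple n [set t | forall i, A i (tnth t i)] =
  (\prod_(i < n) lebesgue1 (A i))%E.
Proof.
move=> mA; set B := mkset _.
have mB : measurable B.
  by rewrite measurable_boxes; apply: sub_sigma_algebra; exists A.
transitivity (\int[lebesgue_tuple n]_t (\1_B t)%:E)%E.
  by rewrite integral_indic// setIT.
transitivity (\int[lebesgue_tuple n]_t \prod_(i < n) (\1_(A i) (tnth t i))%:E)%E.
  apply: eq_integral => t _; rewrite prodEFin; congr EFin.
  rewrite indicE; have [tB|tB] := pselect (B t).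
    rewrite mem_set// big1// => i _; rewrite indicE mem_set//; exact: tB.
  rewrite memNset//; move/existsNP : tB => [i tAi].
  by rewrite (bigD1 i)//= indicE memNset// mul0r.
rewrite (@integral_tuple_prod n (fun i x => (\1_(A i) x)%:E)).
- by apply: eq_bigr => i _; rewrite integral_indic// setIT.
- by move=> i; apply/measurable_EFinP; exact: measurable_indic.
- by move=> i x; rewrite lee_fin.
Qed.

(** Boxes form a pi-system generating the sigma-algebra, and the cubes [-k, k]^n exhaust R^n with
    finite measure, so the values on boxes determine the measure. *)
Lemma lebesgue_tuple_unique n (mu : {measure set (n.-tuple R) -> \bar R}) :
  (forall A : 'I_n -> set R, (forall i, measurable (A i)) ->
    mu [set t | forall i, A i (tnth t i)] = \prod_(i < n) lebesgue1 (A i))%E ->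
  forall B, measurable B -> lebesgue_tuple n B = mu B.
Proof.
move=> muE B mB.
pose I k : set R := `[- k%:R, k%:R]%classic.
have mI k : measurable (I k) by exact: measurable_itv.
apply: (measure_unique (@boxes n)
  (fun k => [set t | forall i, I k (tnth t i)])) => //.
- exact: measurable_boxes.
- exact: setI_closed_boxes.
- by move=> k; exists (fun=> I k).
- apply/seteqP; split => // t _.
  pose M := \sum_(i < n) `|tnth t i|.
  exists (Num.truncn M).+1 => //= i.
  rewrite /I /= in_itv /= -ler_norml; apply: le_trans (ltW (truncnS_gt _)).
  by rewrite /M (bigD1 i)//= lerDl sumr_ge0.
- by move=> _ [A mA ->]; rewrite muE//; exact: lebesgue_tuple_box.
- move=> k; rewrite [X in (X < _)%E](_ : _ =
      \prod_(i < n) lebesgue1 (I k))%E; last first.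
    exact: (lebesgue_tuple_box (fun=> mI k)).
  rewrite (eq_bigr (fun=> (k%:R - - k%:R)%:E)) ?prodEFin ?ltry// => i _.
  rewrite -[LHS]/(lebesgue_measure _) lebesgue_measure_itv/= lte_fin.
  case: ltP => // k0; have : 0 <= k%:R :> R by [].
  by move=> k1; congr EFin; lra.
Qed.

End product_integral.

Section density_integral.
Context d (T : measurableType d) (R : realType).
Variables (mu nu : {measure set T -> \bar R}) (f : T -> R).
Hypothesis mf : measurable_fun setT f.
Hypothesis f0 : forall x, 0 <= f x.
Hypothesis nuE : forall A, measurable A -> nu A = (\int[mu]_(x in A) (f x)%:E)%E.
Import HBNNSimple.

Let integral_density_nnsfun (h : {nnsfun T >-> R}) :
  (\int[nu]_x (h x)%:E = \int[mu]_x ((h x)%:E * (f x)%:E))%E.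
Proof.
have mfE : measurable_fun setT (EFin \o f) by apply/measurable_EFinP.
have m1 r : measurable_fun setT (fun x => (\1_(h @^-1` [set r]) x : R)%:E).
  by apply/measurable_EFinP.
rewrite -[LHS]/(\int[nu]_x (EFin \o h) x)%E integralT_nnsfun sintegralE.
transitivity (\int[mu]_x (\sum_(r \in range h)
    (r * \1_(h @^-1` [set r]) x)%:E * (f x)%:E))%E; last first.
  apply: eq_integral => x _; rewrite -ge0_mule_fsuml; last first.
    by move=> r; exact: nnfun_muleindic_ge0.
  by rewrite fsumEFin// -(fimfunE _ x).
rewrite ge0_integral_fsum//; last 2 first.
- move=> r; apply: emeasurable_funM => //.
  by under eq_fun do rewrite EFinM; exact: measurable_funeM.
- by move=> r x _; apply: mule_ge0; [exact: nnfun_muleindic_ge0|rewrite lee_fin].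
apply: eq_fsbigr => r /set_mem[x _ <-].
under eq_integral do rewrite EFinM -muleA.
rewrite ge0_integralZl//; first last.
- by rewrite lee_fin.
- by move=> y _; rewrite mule_ge0 ?lee_fin.
- by apply: emeasurable_funM => //.
congr mule; rewrite nuE; last exact: measurable_sfunP.
rewrite integral_mkcond; apply: eq_integral => y _.
by rewrite patchE indicE; case: (_ \in _); rewrite /= ?mul1e ?mul0e.
Qed.

(** True for simple functions by linearity, then extended by monotone convergence along the
    approximations of h. *)
Lemma ge0_integral_density (h : T -> \bar R) :
  measurable_fun setT h -> (forall x, 0 <= h x)%E ->
  (\int[nu]_x h x = \int[mu]_x (h x * (f x)%:E))%E.
Proof.
move=> mh h0; pose g := nnsfun_approx measurableT mh.
have mfE : measurable_fun setT (EFin \o f) by apply/measurable_EFinP.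
have gh x : (EFin \o g n) x @[n --> \oo] --> h x by exact: cvg_nnsfun_approx.
have gh' x : ((EFin \o g n) x * (f x)%:E)%E @[n --> \oo] --> (h x * (f x)%:E)%E.
  by apply: cvgeZr.
under eq_integral => x _ do rewrite -(cvg_lim _ (gh x))//.
under [RHS]eq_integral => x _ do rewrite -(cvg_lim _ (gh' x))//.
rewrite !monotone_convergence//=.
- by under eq_fun do rewrite integral_density_nnsfun.
- by move=> n; apply: emeasurable_funM => //; apply/measurable_EFinP.
- by move=> n x _; rewrite mule_ge0 ?lee_fin.
- move=> x _ a b ab; rewrite lee_wpmul2r ?lee_fin//.
  exact/lefP/nd_nnsfun_approx.
- by move=> n; apply/measurable_EFinP.
- by move=> n x _; rewrite lee_fin.
- by move=> x _ a b ab; rewrite lee_fin; exact/lefP/nd_nnsfun_approx.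
Qed.

End density_integral.

Lemma big_disjoint_setU (I : Type) (idx : I) (op : Monoid.com_law idx)
    (T : finType) (A B : {set T}) (F : T -> I) : [disjoint A & B]%B ->
  \big[op/idx]_(i in (A :|: B)%SET) F i =
  op (\big[op/idx]_(i in A) F i) (\big[op/idx]_(i in B) F i).
Proof.
by move=> dAB; rewrite -bigU//; apply: eq_bigl => i; rewrite !inE.
Qed.

Section coordinates.
Context {R : realType}.
Variable n : nat.
Implicit Types (S : {set 'I_n}).

Lemma integral_embed_prod S (f : 'I_n -> R -> \bar R) :
  (forall i, measurable_fun setT (f i)) -> (forall i x, 0 <= f i x)%E ->
  (\int[lebesgue_tuple #|S|]_t \prod_(i in S) f i (tnth (embed t) i) =
   \prod_(i in S) \int[lebesgue1]_x f i x)%E.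
Proof.
move=> mf f0; rewrite big_enum_val -integral_tuple_prod//.
apply: eq_integral => t _; rewrite big_enum_val.
by apply: eq_bigr => j _; rewrite tnth_embed.
Qed.

Lemma tnth_embed_merge S1 S2 (t1 : #|S1|.-tuple R) (t2 : #|S2|.-tuple R) i :
  tnth (embed (merge_coords t1 t2)) i = tnth (embed t1) i + tnth (embed t2) i.
Proof.
have [iS|] := boolP (i \in S1 :|: S2)%SET.
  rewrite -(enum_rankK_in iS iS) tnth_embed /merge_coords /coord_proj.
  by rewrite !tnth_mktuple !enum_rankK_in.
move=> iS; rewrite tnth_embed_out//; move: iS.
by rewrite inE negb_or => /andP[? ?]; rewrite !tnth_embed_out ?addr0.
Qed.

Lemma measurable_merge_coords S1 S2 :
  measurable_fun setT (fun z : #|S1|.-tuple R * #|S2|.-tuple R =>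
    merge_coords z.1 z.2).
Proof.
apply/measurable_fun_tnthP => j.
rewrite (_ : _ \o _ = fun z : #|S1|.-tuple R * #|S2|.-tuple R =>
    tnth (embed z.1) (enum_val j) + tnth (embed z.2) (enum_val j)).
  apply: measurable_funD.
    apply: (measurableT_comp (measurable_tnth (enum_val j))).
    exact: measurableT_comp (@measurable_embed R n S1) _.
  apply: (measurableT_comp (measurable_tnth (enum_val j))).
  exact: measurableT_comp (@measurable_embed R n S2) _.
by apply/funext => z /=; rewrite -tnth_embed_merge tnth_embed.
Qed.

(** The coordinates of S1 and S2 are interleaved in the enumeration of the union, so merging is not
    a concatenation of tuples. The image of the product measure under merging is therefore
    identified with Lebesgue measure through its values on boxes. *)
Lemma integral_merge S1 S2 (F : #|(S1 :|: S2)%SET|.-tuple R -> \bar R) :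
  [disjoint S1 & S2]%B -> measurable_fun setT F -> (forall t, 0 <= F t)%E ->
  (\int[lebesgue_tuple #|(S1 :|: S2)%SET|]_t F t =
   \int[lebesgue_tuple #|S1|]_t1 \int[lebesgue_tuple #|S2|]_t2
     F (merge_coords t1 t2))%E.
Proof.
move=> dS mF F0; set S := (S1 :|: S2)%SET.
pose mrg (z : #|S1|.-tuple R * #|S2|.-tuple R) : #|S|.-tuple R :=
  merge_coords z.1 z.2.
have mmrg : measurable_fun setT mrg by exact: measurable_merge_coords.
pose mu := measure_function_pushforward__canonical__measure_function_Measure
  (lebesgue_tuple #|S1| \x lebesgue_tuple #|S2|)%E mmrg.
have push G : measurable_fun setT G -> (forall t, 0 <= G t)%E ->
    (\int[mu]_t G t = \int[lebesgue_tuple #|S1|]_t1 \int[lebesgue_tuple #|S2|]_t2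
     G (mrg (t1, t2)))%E.
  move=> mG G0; rewrite ge0_integral_pushforward//= fubini_tonelli1//=.
  exact: measurableT_comp.
rewrite -push//; apply: eq_measure_integral => B mB _.
apply: lebesgue_tuple_unique mB => A mA.
(* The sides of the box, reindexed by 'I_n as [integral_embed_prod] expects; outside S the value 1
   is a mere default. *)
pose f i x : \bar R :=
  if insub (index i (enum S)) is Some j then (\1_(A j) x)%:E else 1%E.
have fE (j : 'I_#|S|) x : f (enum_val j) x = (\1_(A j) x)%:E.
  have jE : index (enum_val j) (enum S) = j.
    by rewrite (enum_val_nth (enum_val j)) index_uniq ?enum_uniq// -cardE.
  rewrite /f; case: insubP => [k _|]; last by rewrite jE ltn_ord.
  by rewrite jE => /val_inj ->.
have mf i : measurable_fun setT (f i).
  rewrite /f; case: insubP => [j _ _|_]; last exact: measurable_cst.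
  exact/measurable_EFinP.
have f0 i x : (0 <= f i x)%E.
  by rewrite /f; case: insubP => // j _ _; rewrite lee_fin.
set C := mkset _.
have mC : measurable C.
  by rewrite measurable_boxes; apply: sub_sigma_algebra; exists A.
have CE t : (\1_C t)%:E = (\prod_(i in S) f i (tnth (embed t) i))%E.
  rewrite big_enum_val; under eq_bigr do rewrite fE tnth_embed.
  rewrite prodEFin; congr EFin.
  rewrite indicE; have [tC|tC] := pselect (C t).
    rewrite mem_set// big1// => i _; rewrite indicE mem_set//; exact: tC.
  rewrite memNset//; move/existsNP : tC => [i tAi].
  by rewrite (bigD1 i)//= indicE memNset// mul0r.
transitivity (\int[mu]_t (\1_C t)%:E)%E; first by rewrite integral_indic// setIT.
rewrite push//=; last exact/measurable_EFinP.
transitivity (\prod_(i in S) \int[lebesgue1]_x f i x)%E; last first.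
  rewrite big_enum_val; apply: eq_bigr => j _.
  under eq_integral do rewrite fE.
  by rewrite integral_indic// setIT.
rewrite (big_disjoint_setU _ _ dS)/= -(integral_embed_prod _ mf f0) -ge0_integralZr//=.
- apply: eq_integral => t1 _; rewrite -integral_embed_prod// -ge0_integralZl//=.
  + apply: eq_integral => t2 _.
    rewrite CE (big_disjoint_setU _ _ dS)/=.
    congr mule; apply: eq_bigr => i iS; rewrite tnth_embed_merge.
      by rewrite [X in _ + X]tnth_embed_out ?addr0// (disjointFr dS).
    by rewrite tnth_embed_out ?add0r// (disjointFl dS).
  + apply: measurable_prode => i; apply: measurableT_comp => //.
    by apply: (measurableT_comp (measurable_tnth i)); exact: measurable_embed.
  + by move=> t2 _; exact: prode_ge0.
  + exact: prode_ge0.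
- apply: measurable_prode => i; apply: measurableT_comp => //.
  by apply: (measurableT_comp (measurable_tnth i)); exact: measurable_embed.
- by move=> t1 _; exact: prode_ge0.
- by apply: prode_ge0 => i _; exact: integral_ge0.
Qed.

End coordinates.

(** * Evidence and posterior mass *)

Section posterior.
Context {R : realType}.

Lemma ge0_integral_density_prob n (f : density R n) (h : n.-tuple R -> \bar R) :
  measurable_fun setT h -> (forall x, 0 <= h x)%E ->
  (\int[density_prob f]_x h x =
   \int[lebesgue_tuple n]_x (h x * (f x)%:E))%E.
Proof.
apply: ge0_integral_density => //; first exact: measurable_density.
exact: density_ge0.
Qed.

Definition model_weight (a b : R) n (S : {set 'I_n}) : R :=
  cdim a b n #|S| / 'C(n, #|S|)%:R.

Lemma model_weight_ge0 a b n (S : {set 'I_n}) : 0 <= model_weight a b S.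
Proof. by rewrite divr_ge0 ?cdim_ge0. Qed.

Lemma ge0_integral_complexity_prior (a b : R) n (g : forall k, density R k)
    (h : n.-tuple R -> \bar R) :
  measurable_fun setT h -> (forall x, 0 <= h x)%E ->
  (\int[complexity_prior a b g]_t h t =
   \sum_(S : {set 'I_n}) (model_weight a b S)%:E *
     \int[lebesgue_tuple #|S|]_t (h (embed t) * (g #|S| t)%:E))%E.
Proof.
move=> mh h0.
pose m_ S : {measure set (n.-tuple R) -> \bar R} :=
  mscale (NngNum (model_weight_ge0 a b S))
    (measure_function_pushforward__canonical__measure_function_Measure
      (density_prob (g #|S|)) (@measurable_embed R n S)).
pose e := index_enum {set 'I_n}.
(* [msum] is indexed by natural numbers, so the subsets are listed; the default of [nth] is never
   reached. *)
pose mk k := m_ (nth (finset.set0 : {set _}) e k).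
transitivity (\int[msum mk (size e)]_t h t)%E.
  apply: eq_measure_integral => A mA _.
  rewrite /msum -[LHS]/(\sum_(S <- e) m_ S A)%E.
  by rewrite (big_nth (finset.set0 : {set _})) big_mkord.
rewrite ge0_integral_measure_sum// -/e.
rewrite [RHS](big_nth (finset.set0 : {set _})) big_mkord; apply: eq_bigr => k _.
rewrite ge0_integral_mscale//; congr mule.
rewrite ge0_integral_pushforward//=; last exact: measurable_embed.
rewrite ge0_integral_density_prob//.
by apply: measurableT_comp => //; exact: measurable_embed.
Qed.

End posterior.

Section posterior_basics.
Context {R : realType}.
Variable n : nat.
Implicit Types (Pi : probability (n.-tuple R) R) (B : set (n.-tuple R)).

Lemma normal_pdf1E (m x : R) :
  normal_pdf m 1 x = normal_peak 1 * expR (- ((x - m) ^+ 2 / 2)).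
Proof.
by rewrite normal_pdfE ?oner_neq0// /normal_fun expr1n mulNr.
Qed.

Lemma normal_peak1_gt0 : 0 < normal_peak 1 :> R.
Proof. exact: normal_peak_gt0 (oner_neq0 _). Qed.

Lemma normal_tuple_fun_le (theta x : n.-tuple R) :
  normal_tuple_fun theta x <= normal_peak 1 ^+ n.
Proof.
rewrite /normal_tuple_fun -[in leRHS](card_ord n) -prodr_const.
apply: ler_prod => i _; rewrite normal_pdf_ge0/= normal_pdf1E.
rewrite ler_piMr ?(ltW normal_peak1_gt0)// -[leRHS]expR0 ler_expR oppr_le0.
by rewrite divr_ge0 ?sqr_ge0.
Qed.

Lemma normal_tuple_fun_gt0 (theta x : n.-tuple R) : 0 < normal_tuple_fun theta x.
Proof.
by apply: prodr_gt0 => i _; rewrite normal_pdf1E mulr_gt0 ?expR_gt0 ?normal_peak1_gt0.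
Qed.

Lemma measurable_normal_tuple_fun2 d (T : measurableType d)
    (f g : T -> n.-tuple R) : measurable_fun setT f -> measurable_fun setT g ->
  measurable_fun setT (fun z => normal_tuple_fun (f z) (g z)).
Proof.
move=> mf mg; apply: measurable_prod => i _.
under eq_fun do rewrite normal_pdf1E.
apply: measurable_funM => //; apply: measurableT_comp => //.
apply: measurableT_comp => //; apply: measurable_funM => //.
apply: measurable_funX; apply: measurable_funB.
  exact: (measurableT_comp (measurable_tnth i)).
exact: (measurableT_comp (measurable_tnth i)).
Qed.

Definition evidence Pi B (x : n.-tuple R) : \bar R :=
  (\int[Pi]_(theta in B) (normal_tuple_fun theta x)%:E)%E.

Lemma evidence_indic Pi B x : evidence Pi B x =
  (\int[Pi]_theta (\1_B theta * normal_tuple_fun theta x)%:E)%E.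
Proof.
rewrite /evidence integral_mkcond; apply: eq_integral => theta _.
by rewrite patchE indicE; case: (_ \in _); rewrite ?mul1r ?mul0r.
Qed.

Lemma evidence_ge0 Pi B x : (0 <= evidence Pi B x)%E.
Proof. by apply: integral_ge0 => t _; rewrite lee_fin normal_tuple_fun_ge0. Qed.

Let measurable_lik x :
  measurable_fun setT (fun theta : n.-tuple R => (normal_tuple_fun theta x)%:E).
Proof.
by apply/measurable_EFinP; apply: measurable_normal_tuple_fun2.
Qed.

Lemma evidence_le Pi B x : measurable B ->
  (evidence Pi B x <= evidence Pi setT x)%E.
Proof.
move=> mB; apply: ge0_subset_integral => //.
by move=> t _; rewrite lee_fin normal_tuple_fun_ge0.
Qed.

(** The likelihood is bounded by the n-th power of the normal peak and Pi has mass 1. Hence [fine]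
    loses nothing in the definition of [posterior]. *)
Lemma evidence_fin Pi B x : measurable B -> evidence Pi B x \is a fin_num.
Proof.
move=> mB; rewrite ge0_fin_numE ?evidence_ge0//.
apply: le_lt_trans (evidence_le _ _ mB) _.
apply: (@le_lt_trans _ _ (\int[Pi]_theta (normal_peak 1 ^+ n)%:E)%E).
  apply: ge0_le_integral => //.
  - by move=> t _; rewrite lee_fin normal_tuple_fun_ge0.
  - by move=> t _; rewrite lee_fin normal_tuple_fun_le.
by rewrite integral_cst// [X in (_ * X)%E]probability_setT mule1 ltry.
Qed.

Lemma measurable_evidence Pi B : measurable B ->
  measurable_fun setT (evidence Pi B).
Proof.
move=> mB; rewrite (_ : evidence Pi B =
    fubini_F Pi (fun z => (\1_B z.2 * normal_tuple_fun z.2 z.1)%:E)); last first.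
  by apply/funext => x; rewrite evidence_indic.
apply: measurable_fun_fubini_tonelli_F => [|z]; last first.
  by rewrite lee_fin mulr_ge0 ?normal_tuple_fun_ge0.
apply/measurable_EFinP; apply: measurable_funM.
  exact: (measurableT_comp (measurable_indic mB)).
exact: measurable_normal_tuple_fun2.
Qed.

Lemma posteriorE Pi x B :
  posterior Pi x B = fine (evidence Pi B x) / fine (evidence Pi setT x).
Proof. by []. Qed.

Lemma posterior_ge0 Pi x B : 0 <= posterior Pi x B.
Proof. by rewrite posteriorE divr_ge0// fine_ge0// evidence_ge0. Qed.

Lemma posterior_le1 Pi x B : measurable B -> posterior Pi x B <= 1.
Proof.
move=> mB; rewrite posteriorE.
have [->|D0] := eqVneq (fine (evidence Pi setT x)) 0; first by rewrite invr0 mulr0.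
rewrite ler_pdivrMr ?mul1r; last first.
  by rewrite lt_neqAle eq_sym D0 fine_ge0// evidence_ge0.
by apply: fine_le; rewrite ?evidence_fin// evidence_le.
Qed.

Lemma measurable_posterior Pi B : measurable B ->
  measurable_fun setT (fun x => posterior Pi x B).
Proof.
move=> mB.
have mfine C : measurable C -> measurable_fun setT (fun x => fine (evidence Pi C x)).
  move=> mC; apply: (measurableT_comp (fine_measurable _)) => //.
  exact: measurable_evidence.
(* The inverse becomes a power with exponent -1, a measurable function; both are 0 at 0. *)
rewrite (_ : (fun x => _) = fun x =>
    fine (evidence Pi B x) * (fine (evidence Pi setT x)) `^ (-1)).
  apply: measurable_funM; first exact: mfine.
  by apply: (measurableT_comp (measurable_powR _)); exact: mfine.
by apply/funext => x; rewrite posteriorE powR_inv1// fine_ge0// evidence_ge0.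
Qed.

(* Bounds an expected posterior mass without lower bounding the evidence on an
   event of large probability: any part of the evidence may serve as
   denominator, pointwise in x. *)
Lemma integral_posterior_le Pi B (theta : n.-tuple R) (I : finType)
    (k : I -> R) (G : I -> n.-tuple R -> \bar R) :
  measurable B -> (forall i, 0 <= k i) ->
  (forall i, measurable_fun setT (G i)) -> (forall i x, 0 <= G i x)%E ->
  (forall i, \int[lebesgue_tuple n]_x G i x <= 1)%E ->
  (forall x, evidence Pi B x * (normal_tuple_fun theta x)%:E <=
    evidence Pi setT x * \sum_i (k i)%:E * G i x)%E ->
  (\int[density_prob (normal_tuple_pdf theta)]_x (posterior Pi x B)%:E <=
   (\sum_i k i)%:E)%E.
Proof.
move=> mB k0 mG G0 G1 le_evidence.
have mpost := measurable_posterior Pi mB.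
rewrite ge0_integral_density_prob//; last 2 first.
- exact/measurable_EFinP.
- by move=> x; rewrite lee_fin posterior_ge0.
apply: (@le_trans _ _ (\int[lebesgue_tuple n]_x \sum_i (k i)%:E * G i x)%E).
  apply: ge0_le_integral => //=.
  - by move=> x _; rewrite mule_ge0 ?lee_fin ?posterior_ge0 ?normal_tuple_fun_ge0.
  - apply: emeasurable_funM; first exact/measurable_EFinP.
    by apply/measurable_EFinP; exact: measurable_normal_tuple_fun.
  - by apply: emeasurable_sum => i; exact: measurable_funeM.
  move=> x _; rewrite posteriorE -EFinM.
  have Gs0 : (0 <= \sum_i (k i)%:E * G i x)%E.
    by apply: sume_ge0 => i _; rewrite mule_ge0 ?lee_fin.
  have [->|D0] := eqVneq (fine (evidence Pi setT x)) 0.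
    by rewrite invr0 mulr0 mul0r.
  have {}D0 : 0 < fine (evidence Pi setT x).
    by rewrite lt_neqAle eq_sym D0 fine_ge0// evidence_ge0.
  rewrite mulrAC EFinM lee_pdivrMr// EFinM !fineK ?evidence_fin// muleC.
  by rewrite [leRHS]muleC muleC.
rewrite ge0_integral_sum//; last 2 first.
- by move=> i; exact: measurable_funeM.
- by move=> i x _; rewrite mule_ge0 ?lee_fin.
rewrite -sumEFin; apply: lee_sum => i _.
rewrite ge0_integralZl// ?lee_fin//.
by rewrite -[leRHS]mule1 lee_wpmul2l ?lee_fin.
Qed.

End posterior_basics.

(** * Change of measure between two normal centers *)

Section change_of_center.
Context {R : realType}.
Variable n : nat.

Definition tadd (t u : n.-tuple R) : n.-tuple R :=
  [tuple tnth t i + tnth u i | i < n].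

(** Completing the square: p_m^2 / p_m' is exp((m - m')^2) times the density centered at 2m - m',
    the reflection of m' in m. Integrated, this is the second moment of the likelihood ratio. *)
Lemma normal_pdf_sqr (m m' x : R) :
  normal_pdf m 1 x ^+ 2 =
  normal_pdf m' 1 x * (expR ((m - m') ^+ 2) * normal_pdf (m + (m - m')) 1 x).
Proof.
rewrite !normal_pdf1E exprMn expr2 -!expRM_natl.
set c := normal_peak 1.
rewrite [RHS](_ : _ = c * c * (expR (- ((x - m') ^+ 2 / 2)) *
  expR ((m - m') ^+ 2) * expR (- ((x - (m + (m - m'))) ^+ 2 / 2)))); last by ring.
by congr (_ * _); rewrite -!expRD; congr expR; field.
Qed.

(* Pointwise, p_theta is the geometric mean of lambda p_theta' and
   lambda^-1 p_theta^2 / p_theta', and the latter is a multiple of a normal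
   density again. *)
Lemma integral_change_of_center (Z : n.-tuple R -> R) (theta theta' : n.-tuple R)
    (lambda : R) : 0 < lambda ->
  measurable_fun setT Z -> (forall x, 0 <= Z x <= 1) ->
  (\int[density_prob (normal_tuple_pdf theta)]_x (Z x)%:E <=
   lambda%:E * \int[density_prob (normal_tuple_pdf theta')]_x (Z x)%:E +
   (lambda^-1 * expR (\sum_(i < n) (tnth theta i - tnth theta' i) ^+ 2))%:E)%E.
Proof.
move=> l0 mZ Z01.
have Z0 x : 0 <= Z x by have /andP[] := Z01 x.
have Z1 x : Z x <= 1 by have /andP[] := Z01 x.
set E := expR _; pose th2 := tadd theta (tsub theta theta').
have mZE : measurable_fun setT (EFin \o Z) by apply/measurable_EFinP.
have mN th : measurable_fun setT (fun x : n.-tuple R => (normal_tuple_fun th x)%:E).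
  by apply/measurable_EFinP; exact: measurable_normal_tuple_fun.
have pE x : normal_tuple_fun theta x ^+ 2 =
    normal_tuple_fun theta' x * (E * normal_tuple_fun th2 x).
  rewrite /normal_tuple_fun /E expR_sum -!big_split/= -prodrXl.
  apply: eq_bigr => i _; rewrite (normal_pdf_sqr _ (tnth theta' i)).
  by rewrite !tnth_mktuple.
have le_p x : normal_tuple_fun theta x <=
    lambda * normal_tuple_fun theta' x + lambda^-1 * E * normal_tuple_fun th2 x.
  set u := lambda * _; set v := _ * normal_tuple_fun th2 x.
  have u0 : 0 <= u by rewrite mulr_ge0 ?ltW// normal_tuple_fun_gt0.
  have v0 : 0 <= v.
    by rewrite !mulr_ge0 ?expR_ge0 ?invr_ge0 ?(ltW l0)// normal_tuple_fun_ge0.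
  have uv : normal_tuple_fun theta x ^+ 2 = u * v.
    by rewrite pE /u /v; field; rewrite gt_eqF.
  rewrite -(ler_pXn2r (ltn0Sn 1)) ?nnegrE ?addr_ge0 ?normal_tuple_fun_ge0// uv.
  by nra.
rewrite !ge0_integral_density_prob//.
rewrite -ge0_integralZl//; last 3 first.
- by apply: emeasurable_funM => //; exact: mN.
- by move=> x _; rewrite mule_ge0 ?lee_fin ?normal_tuple_fun_ge0.
- by rewrite lee_fin ltW.
rewrite -[X in (_ <= _ + X)%E]mule1 -(integral_normal_tuple_fun th2).
have lE0 : 0 <= lambda^-1 * E by rewrite mulr_ge0 ?invr_ge0 ?expR_ge0// ltW.
rewrite -ge0_integralZl//; last first.
- by move=> x _; rewrite lee_fin normal_tuple_fun_ge0.
rewrite -ge0_integralD//; last 4 first.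
- by move=> x _; rewrite !mule_ge0 ?lee_fin ?normal_tuple_fun_ge0// ltW.
- by apply: measurable_funeM; apply: emeasurable_funM => //; exact: mN.
- by move=> x _; rewrite mule_ge0 ?lee_fin ?normal_tuple_fun_ge0.
- exact: measurable_funeM.
apply: ge0_le_integral => //=.
- by move=> x _; rewrite mule_ge0 ?lee_fin ?normal_tuple_fun_ge0.
- by apply: emeasurable_funM => //; exact: mN.
- apply: emeasurable_funD; last exact: measurable_funeM.
  by apply: measurable_funeM; apply: emeasurable_funM => //; exact: mN.
move=> x _; rewrite -!EFinM -EFinD lee_fin.
apply: le_trans (ler_wpM2l (Z0 x) (le_p x)) _.
rewrite mulrDr lerD//; first by rewrite mulrCA.
by rewrite ler_piMl// mulr_ge0// normal_tuple_fun_ge0.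
Qed.

End change_of_center.

(** * Decomposition of the evidence over models *)

Section models.
Context {R : realType}.
Variables (n : nat) (g : forall k, density R k).
Implicit Types (S T : {set 'I_n}) (B : set (n.-tuple R)) (theta x : n.-tuple R).

Definition model_evidence S B x : \bar R :=
  (\int[lebesgue_tuple #|S|]_t
     (\1_B (embed t) * normal_tuple_fun (embed t) x * g #|S| t)%:E)%E.

Lemma model_weight_gt0 (a b : R) S : 0 < model_weight a b S.
Proof.
rewrite /model_weight divr_gt0//; last first.
  by rewrite ltr0n bin_gt0 -[leqRHS]card_ord max_card.
rewrite divr_gt0 ?expR_gt0// big_ord_recl ltr_pwDl ?expR_gt0// sumr_ge0// => *.
exact: expR_ge0.
Qed.

Lemma model_evidence_ge0 S B x : (0 <= model_evidence S B x)%E.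
Proof.
apply: integral_ge0 => t _.
by rewrite lee_fin !mulr_ge0// ?normal_tuple_fun_ge0 ?density_ge0.
Qed.

Lemma evidence_complexity_prior (a b : R) B x : measurable B ->
  evidence (complexity_prior a b g) B x =
  (\sum_S (model_weight a b S)%:E * model_evidence S B x)%E.
Proof.
move=> mB; rewrite evidence_indic ge0_integral_complexity_prior//.
- apply/measurable_EFinP; apply: measurable_funM; first exact: measurable_indic.
  exact: measurable_normal_tuple_fun2.
- by move=> t; rewrite lee_fin mulr_ge0// normal_tuple_fun_ge0.
Qed.

(** Expresses that the evidence ratio of S, restricted to B, to T has expectation at most k under
    theta. The product form avoids dividing by an evidence that might vanish. *)
Definition dominated theta B S T (k : R) :=
  exists G : n.-tuple R -> \bar R, [/\ measurable_fun setT G,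
    forall x, (0 <= G x)%E, (\int[lebesgue_tuple n]_x G x <= 1)%E &
    forall x, (model_evidence S B x * (normal_tuple_fun theta x)%:E <=
      k%:E * model_evidence T setT x * G x)%E].

(** Each weighted evidence w_T N_T is a summand of the denominator, so every S can be charged to a
    model T S of its own choice, and several S may share the same one. *)
Lemma integral_posterior_dominated (a b : R) theta B
    (T : {set 'I_n} -> {set 'I_n}) (k : {set 'I_n} -> R) :
  measurable B -> (forall S, 0 <= k S) ->
  (forall S, dominated theta B S (T S) (k S)) ->
  (\int[density_prob (normal_tuple_pdf theta)]_x
     (posterior (complexity_prior a b g) x B)%:E <=
   (\sum_S model_weight a b S / model_weight a b (T S) * k S)%:E)%E.
Proof.
move=> mB k0 /choice[G GP].
have kw0 S : 0 <= model_weight a b S / model_weight a b (T S) * k S.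
  by rewrite mulr_ge0// divr_ge0// model_weight_ge0.
have G0 S x : (0 <= G S x)%E by have [_ + _ _] := GP S; exact.
apply: (integral_posterior_le mB kw0) => //.
- by move=> S; have [] := GP S.
- by move=> S; have [] := GP S.
move=> x; rewrite evidence_complexity_prior//.
have DE := evidence_complexity_prior a b x (measurableT : measurable [set: n.-tuple R]).
set D := evidence _ setT x; have D0 : (0 <= D)%E := evidence_ge0 _ _ _.
have NT S : (model_evidence (T S) setT x <= (model_weight a b (T S))^-1%:E * D)%E.
  rewrite muleC lee_pdivlMr ?model_weight_gt0// muleC /D DE (bigD1 (T S))//=.
  rewrite leeDl// sume_ge0// => U _.
  by rewrite mule_ge0 ?lee_fin ?model_weight_ge0 ?model_evidence_ge0.
rewrite ge0_sume_distrl; last first.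
  by move=> S _; rewrite mule_ge0 ?lee_fin ?model_weight_ge0 ?model_evidence_ge0.
rewrite ge0_sume_distrr; last first.
  by move=> S _; rewrite mule_ge0// lee_fin.
apply: lee_sum => S _; have [_ _ _ /(_ x) le_ST] := GP S.
rewrite -muleA; apply: le_trans (lee_wpmul2l _ le_ST) _.
  by rewrite lee_fin model_weight_ge0.
rewrite !muleA [leRHS](_ : _ = ((model_weight a b S)%:E * (k S)%:E *
    ((model_weight a b (T S))^-1%:E * D) * G S x)%E).
  apply: lee_wpmul2r => //; apply: lee_wpmul2l => //.
  by rewrite mule_ge0 ?lee_fin ?model_weight_ge0.
rewrite !EFinM; congr mule.
by rewrite [RHS]muleA [LHS]muleC; congr mule; rewrite muleAC.
Qed.

End models.

(** * Comparison of models *)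

Section dominated_setU.
Context {R : realType}.
Variables (n : nat) (g : forall k, density R k).
Implicit Types (S : {set 'I_n}) (B : set (n.-tuple R)) (theta x : n.-tuple R).

Lemma tnth_tadd theta x i : tnth (tadd theta x) i = tnth theta i + tnth x i.
Proof. by rewrite tnth_mktuple. Qed.

Lemma measurable_tadd d (T : measurableType d) (f h : T -> n.-tuple R) :
  measurable_fun setT f -> measurable_fun setT h ->
  measurable_fun setT (fun z => tadd (f z) (h z)).
Proof.
move=> mf mh; apply/measurable_fun_tnthP => i.
rewrite (_ : _ \o _ = fun z => tnth (f z) i + tnth (h z) i).
  apply: measurable_funD.
    exact: (measurableT_comp (measurable_tnth i)).
  exact: (measurableT_comp (measurable_tnth i)).
by apply/funext => z /=; rewrite tnth_mktuple.
Qed.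

(* On S2 the two normal densities exchange their centers theta_2 and 0, and
   the part of the evidence of S1 factors out. *)
Lemma normal_tuple_fun_merge theta S1 S2 (t1 : #|S1|.-tuple R)
    (t2 : #|S2|.-tuple R) x : [disjoint S1 & S2]%B ->
  (forall i, i \in S2 -> tnth theta i = 0) ->
  normal_tuple_fun (embed (merge_coords t1 t2)) x * normal_tuple_fun theta x =
  normal_tuple_fun (embed t1) x * normal_tuple_fun (tadd theta (embed t2)) x.
Proof.
move=> dS th0; rewrite /normal_tuple_fun -!big_split/=.
apply: eq_bigr => i _; rewrite tnth_embed_merge tnth_tadd.
have [iS2|iS2] := boolP (i \in S2).
  by rewrite (th0 i)// (@tnth_embed_out _ _ S1) ?(disjointFl dS)// !add0r mulrC.
by rewrite (@tnth_embed_out _ _ S2)// !addr0.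
Qed.

(** Once the centers are exchanged, the integral over t1 is the evidence of S1 and the integral over
    t2 is the [gamma]-mixture of the normal densities centered at theta + t2. This mixture serves as
    G; by Tonelli its mass is 1. The indicator of B is bounded by 1. *)
Lemma dominated_setU theta B S1 S2 (gamma : density R #|S2|) (K : R) :
  [disjoint S1 & S2]%B -> measurable B -> 0 <= K ->
  (forall i, i \in S2 -> tnth theta i = 0) ->
  (forall (t1 : #|S1|.-tuple R) (t2 : #|S2|.-tuple R),
    g #|(S1 :|: S2)%SET| (merge_coords t1 t2) <= K * gamma t2 * g #|S1| t1) ->
  dominated g theta B (S1 :|: S2)%SET S1 K.
Proof.
move=> dS mB K0 th0 gK.
pose F (z : n.-tuple R * #|S2|.-tuple R) :=
  (gamma z.2 * normal_tuple_fun (tadd theta (embed z.2)) z.1)%:E.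
have F0 z : (0 <= F z)%E.
  by rewrite lee_fin mulr_ge0 ?density_ge0 ?normal_tuple_fun_ge0.
have mF : measurable_fun setT F.
  apply/measurable_EFinP; apply: measurable_funM.
    exact: (measurableT_comp (measurable_density gamma)).
  apply: measurable_normal_tuple_fun2 => //.
  apply: measurable_tadd => //.
  exact: (measurableT_comp (@measurable_embed R n S2)).
have membed S : measurable_fun setT (@embed R n S) := @measurable_embed R n S.
exists (fubini_F (lebesgue_tuple #|S2|) F); split.
- exact: measurable_fun_fubini_tonelli_F.
- by move=> x; exact: integral_ge0.
- rewrite [leLHS](fubini_tonelli (m1 := lebesgue_tuple n)
    (m2 := lebesgue_tuple #|S2|) F)//.
  under eq_integral => t2 _.
    rewrite (_ : integral _ _ _ = (gamma t2)%:E); last first.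
      rewrite /F /=; under eq_integral do rewrite EFinM.
      rewrite ge0_integralZl//= ?lee_fin ?density_ge0//.
      - by rewrite integral_normal_tuple_fun mule1.
      - by apply/measurable_EFinP; exact: measurable_normal_tuple_fun.
      - by move=> x _; rewrite lee_fin normal_tuple_fun_ge0.
    over.
  by rewrite integral_density.
move=> x.
have mS S (C : set (n.-tuple R)) : measurable C ->
    measurable_fun setT (fun t : #|S|.-tuple R =>
      (\1_C (embed t) * normal_tuple_fun (embed t) x * g #|S| t)%:E).
  move=> mC; apply/measurable_EFinP; apply: measurable_funM.
    apply: measurable_funM; first exact: (measurableT_comp (measurable_indic mC) (membed S)).
    exact: measurable_normal_tuple_fun2 (membed S) (measurable_cst _).
  exact: measurable_density.
have S0 S (C : set (n.-tuple R)) (t : #|S|.-tuple R) :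
    (0 <= (\1_C (embed t) * normal_tuple_fun (embed t) x * g #|S| t)%:E)%E.
  by rewrite lee_fin !mulr_ge0 ?normal_tuple_fun_ge0 ?density_ge0.
pose f (t : #|(S1 :|: S2)%SET|.-tuple R) :=
  (\1_B (embed t) * normal_tuple_fun (embed t) x * g #|(S1 :|: S2)%SET| t)%:E.
rewrite /model_evidence integral_merge//; last exact: mS.
have mf2 : measurable_fun setT (fun z : #|S1|.-tuple R * #|S2|.-tuple R =>
    f (merge_coords z.1 z.2)).
  have mf := mS (S1 :|: S2)%SET _ mB.
  exact: (measurableT_comp mf (@measurable_merge_coords R n S1 S2)).
have f0 z : (0 <= f z)%E by exact: S0.
have mI : measurable_fun setT (fun t1 =>
    \int[lebesgue_tuple #|S2|]_t2 f (merge_coords t1 t2))%E.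
  have := @measurable_fun_fubini_tonelli_F _ _ _ _ _ (lebesgue_tuple #|S2|) _ mf2.
  by apply => z; exact: f0.
set G := fubini_F _ _ x.
have G0 : (0 <= G)%E by apply: integral_ge0.
have mFx : measurable_fun setT (fun t2 => F (x, t2)).
  by apply: measurableT_comp.
rewrite -ge0_integralZr//; first last.
- by rewrite lee_fin normal_tuple_fun_ge0.
- by move=> t1 _; exact: integral_ge0.
rewrite -muleA [leRHS]muleCA -ge0_integralZr//; first last.
- by rewrite mule_ge0// lee_fin.
- exact: mS.
apply: ge0_le_integral => //.
- by move=> t1 _; rewrite mule_ge0 ?integral_ge0// lee_fin normal_tuple_fun_ge0.
- by apply: emeasurable_funM; [exact: mI|exact: measurable_cst].
- by apply: emeasurable_funM => //; exact: mS.
move=> t1 _.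
have mf1 : measurable_fun setT (fun t2 => f (merge_coords t1 t2)).
  exact: (measurableT_comp mf2 (measurable_pair1 t1)).
rewrite muleA -!ge0_integralZr// ?lee_fin ?normal_tuple_fun_ge0//.
rewrite -ge0_integralZl//; last by apply: mule_ge0; [exact: S0|rewrite lee_fin].
apply: ge0_le_integral => //=.
- by move=> t2 _; rewrite mule_ge0// lee_fin normal_tuple_fun_ge0.
- exact: emeasurable_funM.
- exact: measurable_funeM.
move=> t2 _; rewrite /f /F -!EFinM lee_fin indicT mul1r.
rewrite [leLHS](_ : _ = \1_B (embed (merge_coords t1 t2)) *
  (normal_tuple_fun (embed (merge_coords t1 t2)) x * normal_tuple_fun theta x) *
  g #|(S1 :|: S2)%SET| (merge_coords t1 t2)); last by ring.
rewrite normal_tuple_fun_merge//=.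
set u := normal_tuple_fun _ _; set v := normal_tuple_fun _ _.
have u0 : 0 <= u by exact: normal_tuple_fun_ge0.
have v0 : 0 <= v by exact: normal_tuple_fun_ge0.
rewrite [leRHS](_ : _ = u * v * (K * gamma t2 * g #|S1| t1)); last by ring.
apply: ler_pM (gK t1 t2); rewrite ?mulr_ge0 ?density_ge0//.
by rewrite ler_piMl ?mulr_ge0// indicE lern1 leq_b1.
Qed.

End dominated_setU.

(** * Gaussian integrals and the comparison of S with a larger model *)

Section gaussian.
Context {R : realType}.

(** This is sqrt(pi / c), the integral of exp(- c v^2), written as the inverse peak of the normal
    density of variance 1/(2c). *)
Definition gauss_int (c : R) : R := (normal_peak (Num.sqrt (2 * c)^-1))^-1.

Lemma gauss_int_gt0 c : 0 < c -> 0 < gauss_int c.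
Proof.
move=> c0; rewrite invr_gt0 normal_peak_gt0// gt_eqF// sqrtr_gt0 invr_gt0.
by rewrite mulr_gt0.
Qed.

Lemma measurable_gauss (c m : R) :
  measurable_fun setT (fun v : R => expR (- (c * (v - m) ^+ 2))).
Proof.
apply: measurableT_comp => //; apply: measurableT_comp => //.
apply: measurable_funM => //; apply: measurable_funX.
exact: measurable_funB.
Qed.

Lemma integral_gauss (c m : R) : 0 < c ->
  (\int[lebesgue1]_v (expR (- (c * (v - m) ^+ 2)))%:E = (gauss_int c)%:E)%E.
Proof.
move=> c0; set s := Num.sqrt (2 * c)^-1.
have s0 : s != 0 by rewrite gt_eqF// sqrtr_gt0 invr_gt0 mulr_gt0.
have sE : s ^+ 2 *+ 2 = c^-1.
  rewrite sqr_sqrtr ?invr_ge0 ?mulr_ge0 ?(ltW c0)// -mulr_natr.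
  by field; rewrite gt_eqF.
have p0 := normal_peak_gt0 s0.
rewrite ge0_integral_lebesgue1; last 2 first.
- by apply/measurable_EFinP; exact: measurable_gauss.
- by move=> x; rewrite lee_fin expR_ge0.
transitivity (\int[lebesgue_measure]_v ((gauss_int c)%:E * (normal_pdf m s v)%:E))%E.
  apply: eq_integral => v _; rewrite -EFinM /gauss_int -/s normal_pdfE//.
  rewrite /normal_fun sE invrK mulKf ?gt_eqF//; congr (expR _)%:E.
  by rewrite mulNr mulrC.
rewrite ge0_integralZl//= ?integral_normal_pdf ?mule1//.
- by apply/measurable_EFinP; exact: measurable_normal_pdf.
- by move=> x _; rewrite lee_fin normal_pdf_ge0.
- by rewrite lee_fin ltW// gauss_int_gt0.
Qed.

End gaussian.

Section dominated_ball.
Context {R : realType}.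
Variables (n : nat) (g : forall k, density R k).
Implicit Types (S T : {set 'I_n}) (B : set (n.-tuple R)) (theta x : n.-tuple R).

Definition sqdist_on T theta theta' : R :=
  \sum_(i in T) (tnth theta i - tnth theta' i) ^+ 2.

Let p : R := normal_peak 1.
Let off T x := \prod_(i | i \notin T) normal_pdf 0 1 (tnth x i) : R.

Let off_gt0 T x : 0 < off T x.
Proof.
by apply: prodr_gt0 => i _; rewrite normal_pdf1E mulr_gt0 ?expR_gt0 ?normal_peak1_gt0.
Qed.

(** All centers supported in T share the factor [off T x], which therefore cancels when models
    inside T are compared. *)
Lemma normal_tuple_fun_split T theta x :
  (forall i, i \notin T -> tnth theta i = 0) ->
  normal_tuple_fun theta x =
  (\prod_(i in T) normal_pdf (tnth theta i) 1 (tnth x i)) * off T x.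
Proof.
move=> thT; rewrite /normal_tuple_fun (bigID (mem T))/=; congr (_ * _).
by apply: eq_bigr => i iT; rewrite thT.
Qed.

Let measurable_model S B x : measurable B ->
  measurable_fun setT (fun t : #|S|.-tuple R =>
    (\1_B (embed t) * normal_tuple_fun (embed t) x * g #|S| t)%:E).
Proof.
have membed : measurable_fun setT (@embed R n S) by exact: measurable_embed.
move=> mB; apply/measurable_EFinP; apply: measurable_funM.
  apply: measurable_funM; first exact: (measurableT_comp (measurable_indic mB) membed).
  exact: measurable_normal_tuple_fun2 membed (measurable_cst _).
exact: measurable_density.
Qed.

Let measurable_embed_prod S (F : 'I_n -> R -> R) :
  (forall i, measurable_fun setT (F i)) ->
  measurable_fun setT (fun t : #|S|.-tuple R =>
    (\prod_(i in S) (F i (tnth (embed t) i))%:E)%E).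
Proof.
have membed : measurable_fun setT (@embed R n S) by exact: measurable_embed.
move=> mF; apply: measurable_prode => i; apply/measurable_EFinP.
apply: (measurableT_comp (mF i)).
exact: (measurableT_comp (measurable_tnth i)).
Qed.

(** From (t - theta)^2 <= 2 (t - x)^2 + 2 (x - theta)^2 in each coordinate, the loss of 1/64 turns
    the Gaussian exponent 1/2 into 1/2 + 2/64 = 17/32 around x and leaves 2/64 = 1/32 on x - theta.
    [G0] stands for the value of g_T at theta. *)
Lemma model_evidence_ge T theta x (G0 E : R) : 0 < E -> 0 <= G0 ->
  (forall t : #|T|.-tuple R,
    G0 <= E * expR (64^-1 * sqdist_on T (embed t) theta) * g #|T| t) ->
  ((E^-1 * G0 * off T x * \prod_(i in T) (p * gauss_int (17 / 32)
      * expR (- (32^-1 * (tnth x i - tnth theta i) ^+ 2))))%:E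
    <= model_evidence g T setT x)%E.
Proof.
move=> E0 G00 leG.
pose F i v : R := p * expR (- (32^-1 * (tnth x i - tnth theta i) ^+ 2)) *
  expR (- (17 / 32 * (v - tnth x i) ^+ 2)).
have p0 : 0 < p := normal_peak1_gt0.
have F0 i v : 0 <= F i v by rewrite !mulr_ge0 ?expR_ge0 ?(ltW p0).
have mF i : measurable_fun setT (F i).
  by apply: measurable_funM => //; exact: measurable_gauss.
have k0 : 0 <= E^-1 * G0 * off T x.
  by rewrite !mulr_ge0 ?invr_ge0 ?(ltW E0)// ltW.
rewrite EFinM -prodEFin.
rewrite (eq_bigr (fun i => \int[lebesgue1]_v (F i v)%:E)%E); last first.
  move=> i _; rewrite mulrAC EFinM -(@integral_gauss _ _ (tnth x i))//.
  rewrite -ge0_integralZl//=.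
  - by apply/measurable_EFinP; exact: measurable_gauss.
  - by rewrite lee_fin mulr_ge0 ?expR_ge0 ?(ltW p0).
rewrite -(@integral_embed_prod _ _ _ (fun i v => (F i v)%:E)); last 2 first.
- by move=> i; exact/measurable_EFinP.
- by move=> i v; rewrite lee_fin.
have mFT := measurable_embed_prod (S := T) mF.
rewrite -ge0_integralZl//; last first.
  by move=> t _; apply: prode_ge0 => i _; rewrite lee_fin.
apply: ge0_le_integral => //=.
- move=> t _; rewrite mule_ge0 ?lee_fin//.
  by apply: prode_ge0 => i _; rewrite lee_fin.
- exact: measurable_funeM.
- by apply: measurable_model.
move=> t _; rewrite prodEFin -EFinM lee_fin indicT mul1r.
rewrite (normal_tuple_fun_split (T := T)); last by move=> i /tnth_embed_out.
have le_g : E^-1 * G0 * expR (- (64^-1 * sqdist_on T (embed t) theta)) <= g #|T| t.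
  rewrite expRN ler_pdivrMr ?expR_gt0// mulrC ler_pdivrMr//.
  by apply: le_trans (leG t) _; rewrite le_eqVlt; apply/orP; left; apply/eqP; ring.
apply: (@le_trans _ _ ((\prod_(i in T) normal_pdf (tnth (embed t) i) 1 (tnth x i)) *
    off T x * (E^-1 * G0 * expR (- (64^-1 * sqdist_on T (embed t) theta))))); last first.
  rewrite ler_wpM2l// mulr_ge0 ?(ltW (off_gt0 _ _))//.
  by apply: prodr_ge0 => i _; exact: normal_pdf_ge0.
rewrite [leRHS](_ : _ = E^-1 * G0 * off T x *
    ((\prod_(i in T) normal_pdf (tnth (embed t) i) 1 (tnth x i)) *
     expR (- (64^-1 * sqdist_on T (embed t) theta)))); last by ring.
rewrite ler_wpM2l// /sqdist_on mulr_sumr -sumrN expR_sum -big_split/=.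
apply: ler_prod => i _; rewrite F0/= normal_pdf1E /F -!mulrA.
rewrite ler_wpM2l ?(ltW p0)// -!expRD ler_expR.
set u := tnth x i; set v := tnth theta i; set w := tnth (embed t) i.
have := sqr_ge0 (w - u - (u - v)); nra.
Qed.

(** The product of the two normal densities and exp(|t - theta|^2 / 64) still decays like exp(- |t -
    theta|^2 / 8). Of the decay in x - theta, the factor with 1/32 matches the one in
    [model_evidence_ge] and the factor with 1/8 is kept to build G. *)
Lemma model_evidence_le S T theta x B (G0 E r : R) : S \subset T ->
  measurable B -> (forall i, i \notin T -> tnth theta i = 0) ->
  0 <= E -> 0 <= G0 ->
  (forall t : #|S|.-tuple R,
    g #|S| t <= E * expR (64^-1 * sqdist_on T (embed t) theta) * G0) ->
  (forall t : #|S|.-tuple R, B (embed t) -> r <= sqdist_on T (embed t) theta) ->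
  (model_evidence g S B x * (normal_tuple_fun theta x)%:E <=
    (E * G0 * expR (- (16^-1 * r)) * off T x ^+ 2 *
     \prod_(i in T) (p ^+ 2 * Num.max 1 (gauss_int 16^-1) *
       expR (- (32^-1 * (tnth x i - tnth theta i) ^+ 2)) *
       expR (- (8^-1 * (tnth x i - tnth theta i) ^+ 2))))%:E)%E.
Proof.
move=> ST mB thT E0 G00 leg rB.
have p0 : 0 <= p := normal_peak_ge0 1.
pose e i := p ^+ 2 * expR (- (32^-1 * (tnth x i - tnth theta i) ^+ 2)) *
  expR (- (8^-1 * (tnth x i - tnth theta i) ^+ 2)).
have e0 i : 0 <= e i by rewrite !mulr_ge0 ?expR_ge0 ?sqr_ge0.
pose A := E * G0 * expR (- (16^-1 * r)) * off T x ^+ 2 * \prod_(i in T) e i.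
have A0 : 0 <= A.
  apply: mulr_ge0; last by apply: prodr_ge0 => i _; exact: e0.
  by rewrite !mulr_ge0 ?expR_ge0 ?sqr_ge0 ?(ltW (off_gt0 _ _)).
pose F i v : R := expR (- (16^-1 * (v - tnth theta i) ^+ 2)).
have mF i : measurable_fun setT (F i) by exact: measurable_gauss.
rewrite -ge0_integralZr//; first last.
- by rewrite lee_fin normal_tuple_fun_ge0.
- by move=> t _; rewrite lee_fin !mulr_ge0 ?normal_tuple_fun_ge0 ?density_ge0.
- exact: measurable_model.
have mFS := measurable_embed_prod (S := S) mF.
apply: (@le_trans _ _ (\int[lebesgue_tuple #|S|]_t
    (A%:E * \prod_(i in S) (F i (tnth (embed t) i))%:E))%E).
  apply: ge0_le_integral => //=.
  - move=> t _; rewrite mule_ge0// lee_fin ?normal_tuple_fun_ge0//.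
    by rewrite !mulr_ge0 ?normal_tuple_fun_ge0 ?density_ge0.
  - by apply: emeasurable_funM => //; exact: measurable_model.
  - exact: measurable_funeM.
  move=> t _; rewrite prodEFin -!EFinM lee_fin.
  have [tB|tB] := pselect (B (embed t)); last first.
    rewrite indicE memNset// !mul0r mulr_ge0//.
    by apply: prodr_ge0 => i _; exact: expR_ge0.
  rewrite indicE mem_set// mul1r.
  have -> : normal_tuple_fun (embed t) x =
      (\prod_(i in T) normal_pdf (tnth (embed t) i) 1 (tnth x i)) * off T x.
    apply: normal_tuple_fun_split => i iT; apply: tnth_embed_out.
    by apply: contra iT; exact: (fintype.subsetP ST).
  rewrite (normal_tuple_fun_split _ thT).
  set P1 := \prod_(i in T) _; set P2 := \prod_(i in T) _.
  have P10 : 0 <= P1 by apply: prodr_ge0 => i _; exact: normal_pdf_ge0.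
  have P20 : 0 <= P2 by apply: prodr_ge0 => i _; exact: normal_pdf_ge0.
  set D := sqdist_on T (embed t) theta.
  have leP : P1 * P2 * expR (64^-1 * D) <= \prod_(i in T) e i * expR (- (8^-1 * D)).
    rewrite /P1 /P2 /D /sqdist_on !mulr_sumr -sumrN !expR_sum -!big_split/=.
    apply: ler_prod => i _; rewrite !mulr_ge0 ?normal_pdf_ge0 ?expR_ge0//=.
    rewrite !normal_pdf1E -/p /e.
    set u := tnth x i; set v := tnth theta i; set w := tnth (embed t) i.
    rewrite [leLHS](_ : _ = p ^+ 2 * (expR (- ((u - w) ^+ 2 / 2)) *
      expR (- ((u - v) ^+ 2 / 2)) * expR (64^-1 * (w - v) ^+ 2))); last by ring.
    rewrite [leRHS](_ : _ = p ^+ 2 * (expR (- (32^-1 * (u - v) ^+ 2)) *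
      expR (- (8^-1 * (u - v) ^+ 2)) * expR (- (8^-1 * (w - v) ^+ 2)))); last by ring.
    rewrite ler_wpM2l ?sqr_ge0// -!expRD ler_expR.
    (* With A = u - v and D = w - v the claim is 27/32 A^2 - A D + 23/64 D^2 >= 0; completing the
       square in A leaves a positive multiple of D^2. *)
    have := sqr_ge0 (27 * (u - v) - 16 * (w - v)); have := sqr_ge0 (w - v); nra.
  (* Half of the decay pays for the separation r, the other half keeps the integral over R^S
     finite. *)
  have le8 : expR (- (8^-1 * D)) <=
      expR (- (16^-1 * r)) * \prod_(i in S) F i (tnth (embed t) i).
    rewrite /F -expR_sum -expRD ler_expR.
    have rD : r <= D := rB _ tB.
    have : \sum_(i in S) (tnth (embed t) i - tnth theta i) ^+ 2 <= D.
      rewrite /D /sqdist_on [leRHS](big_setID S)/= (finset.setIidPr ST) lerDl.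
      by apply: sumr_ge0 => i _; exact: sqr_ge0.
    rewrite sumrN -mulr_sumr; lra.
  rewrite [leLHS](_ : _ = P1 * P2 * off T x ^+ 2 * g #|S| t); last by ring.
  apply: (@le_trans _ _ (P1 * P2 * off T x ^+ 2 * (E * expR (64^-1 * D) * G0))).
    by rewrite ler_wpM2l // mulr_ge0 ?sqr_ge0// mulr_ge0.
  rewrite [leLHS](_ : _ = E * G0 * off T x ^+ 2 * (P1 * P2 * expR (64^-1 * D)));
    last by ring.
  rewrite [leRHS](_ : _ = E * G0 * off T x ^+ 2 * (\prod_(i in T) e i *
    (expR (- (16^-1 * r)) * \prod_(i in S) F i (tnth (embed t) i)))); last first.
    by rewrite /A; ring.
  rewrite ler_wpM2l ?(mulr_ge0 (mulr_ge0 E0 G00) (sqr_ge0 _))//.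
  apply: le_trans leP _; rewrite ler_wpM2l//.
  by apply: prodr_ge0 => i _; exact: e0.
rewrite ge0_integralZl//; last first.
  by move=> t _; apply: prode_ge0 => i _; rewrite lee_fin expR_ge0.
rewrite (@integral_embed_prod _ _ _ (fun i v => (F i v)%:E)); last 2 first.
- by move=> i; exact/measurable_EFinP.
- by move=> i v; rewrite lee_fin expR_ge0.
rewrite (eq_bigr (fun=> (gauss_int 16^-1)%:E)); last first.
  by move=> i _; exact: integral_gauss.
rewrite prodEFin -EFinM lee_fin prodr_const.
(* J >= 1 allows the power to grow from the size of S to that of T. *)
set J := Num.max 1 _.
have J1 : 1 <= J by rewrite le_max lexx.
rewrite (eq_bigr (fun i => J * e i)); last by move=> i _; rewrite /e; ring.
rewrite big_split/= prodr_const [leRHS](_ : _ = A * J ^+ #|T|); last first.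
  by rewrite /A; ring.
rewrite ler_wpM2l//; apply: (@le_trans _ _ (J ^+ #|S|)).
  by rewrite lerXn2r ?nnegrE ?(ltW (gauss_int_gt0 _))// ?le_max ?lexx ?orbT// (le_trans ler01).
by rewrite ler_weXn2l// subset_leq_card.
Qed.

(** Price per coordinate of T: the constant of the upper bound times the normalization of G, divided
    by the constant of the lower bound; one of the two peaks cancels. *)
Definition ball_rate : R :=
  p * Num.max 1 (gauss_int 16^-1) * gauss_int 8^-1 / gauss_int (17 / 32).

Lemma ball_rate_gt0 : 0 < ball_rate.
Proof.
have J0 : 0 < Num.max 1 (gauss_int 16^-1) :> R by rewrite lt_max ltr01.
have I0 c : 0 < c -> 0 < gauss_int c :> R by exact: gauss_int_gt0.
apply: divr_gt0; last by apply: I0; rewrite divr_gt0.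
by apply: mulr_gt0; [exact: mulr_gt0 normal_peak1_gt0 J0|apply: I0; rewrite invr_gt0].
Qed.

(* The densities g enter only through their value at theta, which cancels. *)
Lemma dominated_ball S T theta B (G0 E E' r : R) : S \subset T ->
  measurable B -> (forall i, i \notin T -> tnth theta i = 0) ->
  0 < E -> 0 <= E' -> 0 <= G0 ->
  (forall t : #|T|.-tuple R,
    G0 <= E * expR (64^-1 * sqdist_on T (embed t) theta) * g #|T| t) ->
  (forall t : #|S|.-tuple R,
    g #|S| t <= E' * expR (64^-1 * sqdist_on T (embed t) theta) * G0) ->
  (forall t : #|S|.-tuple R, B (embed t) -> r <= sqdist_on T (embed t) theta) ->
  dominated g theta B S T
    (E * E' * expR (- (16^-1 * r)) * ball_rate ^+ #|T|).
Proof.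
move=> ST mB thT E0 E'0 G00 leG leg rB.
have p0 : 0 < p := normal_peak1_gt0.
have J0 : 0 < Num.max 1 (gauss_int 16^-1) :> R by rewrite lt_max ltr01.
have I8 : 0 < gauss_int 8^-1 :> R by rewrite gauss_int_gt0 ?invr_gt0.
have I17 : 0 < gauss_int (17 / 32) :> R by rewrite gauss_int_gt0 ?divr_gt0.
(* G is a product of normal densities, of variance 4 around theta on T and standard elsewhere. *)
pose f i v : R := if i \in T then
  (gauss_int 8^-1)^-1 * expR (- (8^-1 * (v - tnth theta i) ^+ 2))
  else normal_pdf 0 1 v.
have f0 i v : 0 <= f i v.
  by rewrite /f; case: ifP => _; rewrite ?normal_pdf_ge0// mulr_ge0 ?expR_ge0// invr_ge0 ltW.
have mf i : measurable_fun setT (f i).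
  rewrite /f; case: (i \in T); last exact: measurable_normal_pdf.
  by apply: measurable_funM => //; exact: measurable_gauss.
pose G x := (\prod_(i < n) (f i (tnth x i))%:E)%E.
have GE x : G x = (off T x * \prod_(i in T) ((gauss_int 8^-1)^-1 *
    expR (- (8^-1 * (tnth x i - tnth theta i) ^+ 2))))%:E.
  rewrite /G prodEFin (bigID (mem T))/= mulrC; congr (_ * _)%:E.
    by apply: eq_bigr => i /negbTE iT; rewrite /f iT.
  by apply: eq_bigr => i iT; rewrite /f iT.
exists G; split.
- apply: measurable_prode => i; apply/measurable_EFinP.
  exact: (measurableT_comp (mf i) (measurable_tnth i)).
- by move=> x; apply: prode_ge0 => i _; rewrite lee_fin.
- rewrite (@integral_tuple_prod _ _ (fun i v => (f i v)%:E)); last 2 first.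
  + by move=> i; exact/measurable_EFinP.
  + by move=> i v; rewrite lee_fin.
  rewrite big1// => i _; rewrite /f; case: (i \in T).
    under eq_integral do rewrite EFinM.
    rewrite ge0_integralZl//= ?integral_gauss//.
    * by rewrite -EFinM mulVf// gt_eqF.
    * by apply/measurable_EFinP; exact: measurable_gauss.
    * by rewrite lee_fin invr_ge0 ltW.
  rewrite ge0_integral_lebesgue1 ?integral_normal_pdf//.
    by apply/measurable_EFinP; exact: measurable_normal_pdf.
  by move=> v; rewrite lee_fin normal_pdf_ge0.
move=> x; have q0 : 0 <= ball_rate by exact: ltW ball_rate_gt0.
apply: le_trans (model_evidence_le x ST mB thT E'0 G00 leg rB) _.
apply: (@le_trans _ _ ((E * E' * expR (- (16^-1 * r)) * ball_rate ^+ #|T|)%:E *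
   (E^-1 * G0 * off T x * \prod_(i in T) (p * gauss_int (17 / 32)
      * expR (- (32^-1 * (tnth x i - tnth theta i) ^+ 2))))%:E * G x)%E); last first.
  apply: lee_wpmul2r; first by apply: prode_ge0 => i _; rewrite lee_fin.
  apply: lee_wpmul2l; last exact: model_evidence_ge.
  by rewrite lee_fin !mulr_ge0 ?expR_ge0 ?exprn_ge0 ?(ltW E0).
rewrite GE -!EFinM lee_fin -(prodr_const (mem T)).
set P1 := \prod_(i in T) _; set P2 := \prod_(i in T) _.
set P3 := \prod_(i in T) _; set P4 := \prod_(i in T) _.
have -> : P1 = P2 * P3 * P4.
  rewrite -!big_split; apply: eq_bigr => i _ /=; rewrite /ball_rate.
  by field; rewrite !gt_eqF.
rewrite le_eqVlt; apply/orP; left; apply/eqP; field.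
by rewrite gt_eqF.
Qed.

End dominated_ball.

(** * Model weights *)

Section weights.
Context {R : realType}.
Variables (a b : R) (n : nat).
Hypotheses (a1 : 1 <= a) (b4 : expR 4 <= b).

Let b0 : 0 < b.
Proof. by apply: lt_le_trans b4; exact: expR_gt0. Qed.

Let lnb4 : 4 <= ln b.
Proof. by rewrite -ler_expR lnK ?posrE. Qed.

(** [cweight a b n p] is exp(- a * entropy p). The argument is real because it will be a multiple of
    the rate k. *)
Definition entropy (x : R) : R := x * ln (b * n%:R / x).

Lemma ln_entropy_ge (x : R) : 0 < x <= n%:R -> ln b <= ln (b * n%:R / x).
Proof.
move=> /andP[x0 xn]; rewrite ler_ln ?posrE ?divr_gt0 ?mulr_gt0//.
  by rewrite ler_pdivlMr// ler_pM2l.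
exact: lt_le_trans x0 xn.
Qed.

Lemma entropy_ge (x : R) : 0 <= x <= n%:R -> x * ln b <= entropy x.
Proof.
move=> /andP[x0 xn]; have [->|x00] := eqVneq x 0; first by rewrite /entropy !mul0r.
by rewrite ler_wpM2l// ln_entropy_ge// xn lt_def x00 x0.
Qed.

Lemma entropy_ge0 (x : R) : 0 <= x <= n%:R -> 0 <= entropy x.
Proof.
move=> xn; apply: le_trans (entropy_ge xn); case/andP: xn => x0 _.
by rewrite mulr_ge0// (le_trans _ lnb4).
Qed.

(** The difference is (y - x) ln(b n / y) - x ln(y / x), where the logarithm in the first term is at
    least 1 and the second term is at most y - x. *)
Lemma entropy_le (x y : R) : 0 <= x -> x <= y -> y <= n%:R -> entropy x <= entropy y.
Proof.
move=> x0 xy yn; have [->|x00] := eqVneq x 0.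
  by rewrite {1}/entropy mul0r entropy_ge0// yn (le_trans x0).
have {x00 x0}x0 : 0 < x by rewrite lt_def x00.
have y0 : 0 < y by exact: lt_le_trans x0 xy.
have n0 : 0 < n%:R :> R by exact: lt_le_trans y0 yn.
have lnx : ln (b * n%:R / x) = ln (b * n%:R / y) + ln (y / x).
  rewrite -lnM ?posrE ?divr_gt0 ?mulr_gt0//; congr ln.
  by field; rewrite !gt_eqF.
have lnyx : x * ln (y / x) <= y - x.
  have : ln (y / x) <= y / x - 1.
    rewrite -ler_expR lnK ?posrE ?divr_gt0//.
    by apply: le_trans (expR_ge1Dx _); lra.
  by rewrite -(ler_pM2l x0) => /le_trans; apply; rewrite mulrBr mulr1 mulrC divfK// gt_eqF.
have lny : 1 <= ln (b * n%:R / y).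
  by apply: le_trans (ln_entropy_ge _); [apply: le_trans lnb4; lra|rewrite y0].
rewrite /entropy lnx mulrDr.
have : 0 <= y - x by lra.
move=> /(ler_wpM2l)/(_ _ _ lny); lra.
Qed.

(** A single term of the expansion of (1 + t/n)^n <= e^t gives the bound (e n / t)^t, and e <= b. *)
Lemma bin_le_entropy t : (t <= n)%N -> 'C(n, t)%:R <= expR (entropy t%:R).
Proof.
case: t => [|t] tn; first by rewrite bin0 /entropy mul0r expR0.
have n0 : 0 < n%:R :> R by rewrite ltr0n (leq_trans _ tn).
set T : R := t.+1%:R; have T0 : 0 < T by rewrite ltr0n.
have : 'C(n, t.+1)%:R * (T / n%:R) ^+ t.+1 <= expR T.
  apply: (@le_trans _ _ ((1 + T / n%:R) ^+ n)).
    rewrite exprDn (bigD1 (Ordinal (tn : t.+1 < n.+1)%N))//=.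
    rewrite expr1n mul1r mulr_natl lerDl sumr_ge0// => i _.
    by rewrite expr1n mul1r mulrn_wge0// exprn_ge0// divr_ge0// ltW.
  apply: (@le_trans _ _ (expR (T / n%:R) ^+ n)).
    rewrite lerXn2r ?nnegrE ?expR_ge0 ?addr_ge0 ?divr_ge0 ?(ltW T0)//.
    exact: expR_ge1Dx.
  by rewrite -expRM_natl mulrC divfK ?gt_eqF.
rewrite -ler_pdivlMr ?exprn_gt0 ?divr_gt0// => /le_trans; apply.
rewrite -exprVn invf_div -[n%:R / T]lnK ?posrE ?divr_gt0//.
rewrite -expRM_natl -expRD ler_expR /entropy -/T.
have -> : ln (b * n%:R / T) = ln b + ln (n%:R / T).
  by rewrite -lnM ?posrE ?divr_gt0// mulrA.
rewrite mulrDr lerD2r -[leLHS]mulr1 ler_wpM2l ?(ltW T0)//.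
by apply: le_trans lnb4; lra.
Qed.

Lemma sum_card_weight (h : nat -> R) :
  \sum_(S : {set 'I_n}) h #|S| / 'C(n, #|S|)%:R = \sum_(p < n.+1) h p.
Proof.
pose c (S : {set 'I_n}) : 'I_n.+1 := inord #|S|.
have cE S : c S = #|S| :> nat by rewrite inordK// ltnS -[leqRHS]card_ord max_card.
rewrite (partition_big c xpredT)//=; apply: eq_bigr => p _.
rewrite (eq_bigr (fun=> h p / 'C(n, p)%:R)); last by move=> S /eqP <-; rewrite cE.
rewrite sumr_const (_ : #|_| = 'C(n, p)); last first.
  transitivity #|[set S : {set 'I_n} | #|S| == p]%SET|.
    by apply: eq_card => S; rewrite [RHS]inE -[in RHS]cE.
  by rewrite card_draws card_ord.
by rewrite -[LHS]mulr_natr divfK// pnatr_eq0 -lt0n bin_gt0 -ltnS.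
Qed.

Lemma sum_expRN_le2 N : \sum_(p < N) expR (- p%:R) <= 2 :> R.
Proof.
suff : \sum_(p < N) expR (- p%:R) <= 2 - 2 * expR (- N%:R) :> R.
  move=> /le_trans; apply; have := expR_ge0 (- N%:R : R); lra.
elim: N => [|N IH]; first by rewrite big_ord0 oppr0 expR0; lra.
rewrite big_ord_recr /=.
have -> : expR (- N.+1%:R) = expR (- N%:R) * expR (- 1) :> R.
  by rewrite -expRD -opprD natr1.
have : expR (- 1) <= 2^-1 :> R.
  rewrite expRN lef_pV2 ?posrE ?expR_gt0//.
  by apply: le_trans (expR_ge1Dx _); lra.
have := expR_gt0 (- N%:R : R); nra.
Qed.

(** The normalizing sum cancels. The prior of T costs a entropies, and its binomial coefficient one
    more. *)
Lemma model_weight_ratio (S T : {set 'I_n}) :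
  model_weight a b S / model_weight a b T <=
  cweight a b n #|S| / 'C(n, #|S|)%:R * expR ((a + 1) * entropy #|T|%:R).
Proof.
have Tn : (#|T| <= n)%N by rewrite -[leqRHS]card_ord max_card.
have Sn : (#|S| <= n)%N by rewrite -[leqRHS]card_ord max_card.
have bin0 t : (t <= n)%N -> 0 < 'C(n, t)%:R :> R by rewrite ltr0n bin_gt0.
set Z := \sum_(k < n.+1) cweight a b n k.
have Z0 : 0 < Z.
  by rewrite /Z big_ord_recl ltr_pwDl ?expR_gt0// sumr_ge0// => *; exact: expR_ge0.
rewrite [leLHS](_ : _ = cweight a b n #|S| / 'C(n, #|S|)%:R *
    ('C(n, #|T|)%:R / cweight a b n #|T|)); last first.
  rewrite /model_weight /cdim -/Z; field.
  by rewrite !gt_eqF ?bin0 ?expR_gt0.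
rewrite ler_wpM2l ?divr_ge0 ?expR_ge0//.
rewrite /cweight -expRN opprK mulrDl mul1r addrC expRD -mulrA.
by rewrite ler_wpM2r ?expR_ge0// bin_le_entropy.
Qed.

Lemma cweight_le p : (p <= n)%N -> cweight a b n p <= expR (- entropy p%:R).
Proof.
move=> pn; rewrite /cweight ler_expR lerN2 -mulrA -/(entropy _).
by rewrite ler_peMl// entropy_ge0// ler0n ler_nat.
Qed.

(** The binomial coefficient of S offsets the number of models of its size s. Half of the entropy of
    s gives the decay in kappa; the other half is at least (s / 2) ln b, of which one part absorbs
    m^s since m^4 <= b and the other leaves the summable e^(- s) since b >= e^4. *)
Lemma sum_weight_large (m k kappa : R) (T : {set 'I_n} -> {set 'I_n}) :
  0 < m -> m ^+ 4 <= b -> 0 <= kappa -> k <= n%:R ->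
  (forall S, #|T S|%:R <= k) ->
  \sum_(S : {set 'I_n} | kappa < #|S|%:R)
    model_weight a b S / model_weight a b (T S) * m ^+ #|S| <=
  2 * expR (- (2^-1 * entropy kappa) + (a + 1) * entropy k).
Proof.
move=> m0 m4b kappa0 kn Tk.
have lnm : 4 * ln m <= ln b.
  by rewrite mulr_natl -lnXn// ler_ln ?posrE// exprn_gt0.
set E := expR _.
pose h p := expR (- p%:R) * E.
apply: (@le_trans _ _ (\sum_(S : {set 'I_n}) h #|S| / 'C(n, #|S|)%:R)); last first.
  rewrite sum_card_weight -mulr_suml ler_wpM2r ?expR_ge0//.
  exact: sum_expRN_le2.
rewrite big_mkcond; apply: ler_sum => S _.
have h0 : 0 <= h #|S| / 'C(n, #|S|)%:R by rewrite !mulr_ge0 ?expR_ge0.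
case: ifP => // kS; set s := #|S| in kS h0 *.
have sn : (s <= n)%N by rewrite -[leqRHS]card_ord max_card.
apply: (@le_trans _ _ (cweight a b n s / 'C(n, s)%:R *
    expR ((a + 1) * entropy k) * m ^+ s)).
  rewrite ler_wpM2r ?exprn_ge0 ?(ltW m0)//.
  apply: le_trans (model_weight_ratio _ _) _.
  rewrite ler_wpM2l ?divr_ge0 ?expR_ge0// ler_expR ler_wpM2l//.
    by apply: addr_ge0 => //; exact: le_trans ler01 a1.
  exact: entropy_le.
rewrite [leLHS](_ : _ = cweight a b n s * expR ((a + 1) * entropy k) * m ^+ s /
  'C(n, s)%:R); last by ring.
rewrite ler_wpM2r ?invr_ge0//.
apply: (@le_trans _ _ (expR (- entropy s%:R) * expR ((a + 1) * entropy k) * m ^+ s)).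
  rewrite ler_wpM2r ?exprn_ge0 ?(ltW m0)// ler_wpM2r ?expR_ge0//.
  exact: cweight_le.
rewrite -[m in m ^+ s]lnK ?posrE// -expRM_natl -!expRD /h /E -expRD ler_expR.
have s0n : 0 <= (s%:R : R) <= n%:R by rewrite ler0n ler_nat.
have e1 := entropy_ge s0n.
have e2 : entropy kappa <= entropy s%:R.
  by apply: entropy_le => //; [exact: ltW|rewrite ler_nat].
have s0 : 0 <= s%:R :> R by [].
have := ler_wpM2l s0 lnm; have := ler_wpM2l s0 lnb4; lra.
Qed.

(** The weights are only asked to be summable over S here; the smallness has to come from E. *)
Lemma sum_weight_small (k E : R) (T : {set 'I_n} -> {set 'I_n}) (P : pred {set 'I_n}) :
  0 <= E -> k <= n%:R ->
  (forall S, P S -> #|T S|%:R <= k) ->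
  \sum_(S : {set 'I_n} | P S)
    model_weight a b S / model_weight a b (T S) * E <=
  2 * expR ((a + 1) * entropy k) * E.
Proof.
move=> E0 kn Tk; rewrite -mulr_suml ler_wpM2r//.
set F := expR _.
pose h p := expR (- p%:R) * F.
apply: (@le_trans _ _ (\sum_(S : {set 'I_n}) h #|S| / 'C(n, #|S|)%:R)); last first.
  rewrite sum_card_weight -mulr_suml ler_wpM2r ?expR_ge0//.
  exact: sum_expRN_le2.
rewrite big_mkcond; apply: ler_sum => S _.
have h0 : 0 <= h #|S| / 'C(n, #|S|)%:R by rewrite !mulr_ge0 ?expR_ge0.
case: ifP => // PS; set s := #|S| in h0 *.
have sn : (s <= n)%N by rewrite -[leqRHS]card_ord max_card.
apply: le_trans (model_weight_ratio _ _) _.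
rewrite /h [leRHS]mulrAC; apply: ler_pM; rewrite ?divr_ge0 ?expR_ge0//.
  rewrite ler_wpM2r ?invr_ge0//; apply: le_trans (cweight_le sn) _.
  have s0n : 0 <= (s%:R : R) <= n%:R by rewrite ler0n ler_nat.
  rewrite ler_expR lerN2; apply: le_trans (entropy_ge s0n).
  have s0 : 0 <= s%:R :> R by [].
  have := ler_wpM2l s0 lnb4; lra.
rewrite ler_expR ler_wpM2l//.
  by apply: addr_ge0 => //; exact: le_trans ler01 a1.
by apply: entropy_le => //; exact: Tk.
Qed.

End weights.

(** * Posterior bound for a sparse truth *)

Section sparse_truth.
Context {R : realType}.
Variables (c1 C m1 : R) (n : nat) (g : forall k, density R k).
Hypotheses (C0 : 0 < C) (m10 : 0 < m1).
Hypothesis g_gt0 : forall (S : {set 'I_n}) (t : #|S|.-tuple R), 0 < g #|S| t.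
Hypothesis g_smooth : forall (S : {set 'I_n}) (t t' : #|S|.-tuple R),
  ln (g #|S| t) - ln (g #|S| t')
    <= c1 * #|S|%:R + 64^-1 * enorm (tsub t t') ^+ 2.
Hypothesis g_nested : forall (S' S : {set 'I_n}) (t : #|S|.-tuple R),
  S' \subset S ->
  `| ln (g #|S| t) - ln (g #|S'| (coord_proj S' (embed t))) |
    <= c1 * #|S|%:R + 64^-1 * enorm (coord_proj (S :\: S')%SET (embed t)) ^+ 2.
Hypothesis g_split : forall S2 : {set 'I_n}, exists gamma : density R #|S2|,
  forall (t2 : #|S2|.-tuple R) (S1 : {set 'I_n}), S1 \subset (~: S2)%SET ->
  (ereal_sup [set (g #|S1 :|: S2| (merge_coords t1 t2) / g #|S1| t1)%:E
             | t1 in [set: #|S1|.-tuple R]]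
    <= (C * m1 ^+ (#|S1| + #|S2|) * gamma t2)%:E)%E.
Implicit Types (S T : {set 'I_n}) (theta : n.-tuple R).

Lemma enorm_sqr k (t : k.-tuple R) : enorm t ^+ 2 = \sum_(i < k) tnth t i ^+ 2.
Proof. by rewrite sqr_sqrtr// sumr_ge0// => i _; exact: sqr_ge0. Qed.

Lemma embed_coord_proj T theta : (forall i, i \notin T -> tnth theta i = 0) ->
  embed (coord_proj T theta) = theta.
Proof.
move=> th0; apply: eq_from_tnth => i; have [iT|iT] := boolP (i \in T).
  by rewrite -(enum_rankK_in iT iT) tnth_embed tnth_mktuple.
by rewrite tnth_embed_out// th0.
Qed.

Lemma enorm_tsub_coord_proj T theta theta' :
  enorm (tsub (coord_proj T theta) (coord_proj T theta')) ^+ 2 =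
  sqdist_on T theta theta'.
Proof.
rewrite enorm_sqr /sqdist_on [RHS]big_enum_val; apply: eq_bigr => j _.
by rewrite !tnth_mktuple.
Qed.

Lemma smooth_at T theta (t : #|T|.-tuple R) :
  g #|T| (coord_proj T theta) <= expR (c1 * #|T|%:R) *
    expR (64^-1 * sqdist_on T (embed t) theta) * g #|T| t.
Proof.
rewrite -[X in X <= _]lnK ?posrE// -[X in _ * X]lnK ?posrE// -!expRD ler_expR.
have := g_smooth (coord_proj T theta) t.
rewrite -{2}(coord_projK t) enorm_tsub_coord_proj.
rewrite (_ : sqdist_on T theta _ = sqdist_on T (embed t) theta); first lra.
by apply: eq_bigr => i _; rewrite -sqrrN opprB.
Qed.

(** Padding t with zeros gives u in R^T. Passing from g_S(t) to g_T(u) costs only c1 |T|, since u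
    vanishes on T minus S; passing from u to theta costs another c1 |T| and the quadratic term. *)
Lemma nested_at S T theta (t : #|S|.-tuple R) : S \subset T ->
  g #|S| t <= expR (2 * c1 * #|T|%:R) *
    expR (64^-1 * sqdist_on T (embed t) theta) * g #|T| (coord_proj T theta).
Proof.
move=> ST; pose u := coord_proj T (embed t).
have uE : embed u = embed t.
  apply: embed_coord_proj => i iT; apply: tnth_embed_out.
  by apply: contra iT; exact: (fintype.subsetP ST).
rewrite -[X in X <= _]lnK ?posrE// -[X in _ * X]lnK ?posrE// -!expRD ler_expR.
have := g_nested u ST; rewrite uE coord_projK enorm_sqr big1; last first.
  move=> j _; rewrite tnth_mktuple tnth_embed_out ?expr0n//.
  by have := enum_valP j; rewrite inE => /andP[].
rewrite mulr0 addr0 ler_norml => /andP[+ _].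
have := g_smooth u (coord_proj T theta); rewrite enorm_tsub_coord_proj; lra.
Qed.

Lemma split_at S1 S2 : [disjoint S1 & S2]%B -> exists gamma : density R #|S2|,
  forall (t1 : #|S1|.-tuple R) (t2 : #|S2|.-tuple R),
    g #|(S1 :|: S2)%SET| (merge_coords t1 t2) <=
    C * m1 ^+ #|(S1 :|: S2)%SET| * gamma t2 * g #|S1| t1.
Proof.
move=> dS; have [gamma gP] := g_split S2; exists gamma => t1 t2.
have S12 : S1 \subset (~: S2)%SET by rewrite -finset.disjoints_subset.
have -> : m1 ^+ #|(S1 :|: S2)%SET| = m1 ^+ (#|S1| + #|S2|).
  move: dS; rewrite -finset.setI_eq0 => /eqP dS.
  by rewrite cardsU dS cards0 subn0.
rewrite -ler_pdivrMr//.
rewrite -lee_fin; apply: le_trans (gP t2 S1 S12).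
by apply: ereal_sup_ubound; exists t1.
Qed.

Variables (a b : R).
Hypotheses (a1 : 1 <= a) (b4 : expR 4 <= b) (m14b : m1 ^+ 4 <= b).
(** Here [q] is a cost per coordinate, not the exponent of [dq]: c1 from [smooth_at], 2 c1 from
    [nested_at], and the logarithm of [ball_rate]. *)
Variable q : R.
Hypotheses (q0 : 0 <= q) (le_q : 3 * c1 + ln (@ball_rate R) <= q).

(** B enters only through its separation r from theta within models of size at most kappa. Both
    events of the theorem fit: one is separated in d_q, the other does not meet the small models at
    all. *)
Lemma posterior_sparse_le (S0 : {set 'I_n}) theta (B : set (n.-tuple R))
    (k kappa r : R) : measurable B ->
  (forall i, i \notin S0 -> tnth theta i = 0) ->
  #|S0|%:R <= k -> 0 <= kappa -> kappa + k <= n%:R ->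
  (forall S (t : #|S|.-tuple R), #|S|%:R <= kappa -> B (embed t) ->
    r <= sqdist_on (S :|: S0)%SET (embed t) theta) ->
  (\int[density_prob (normal_tuple_pdf theta)]_x
     (posterior (complexity_prior a b g) x B)%:E <=
   (2 * C * expR (- (2^-1 * entropy b n kappa) + (a + 1) * entropy b n k) +
    2 * expR ((a + 1) * entropy b n (kappa + k) + q * (kappa + k) - 16^-1 * r)
   )%:E)%E.
Proof.
move=> mB th0 S0k kappa0 kn rB.
pose T S := if kappa < #|S|%:R then (S :&: S0)%SET else (S :|: S0)%SET.
pose E := expR (q * (kappa + k) - 16^-1 * r).
pose K S := if kappa < #|S|%:R then C * m1 ^+ #|S| else E.
have K0 S : 0 <= K S.
  by rewrite /K; case: ifP => _; rewrite ?expR_ge0// mulr_ge0 ?exprn_ge0 ?ltW.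
have k0 : 0 <= k by apply: le_trans S0k.
have dom S : dominated g theta B S (T S) (K S).
  rewrite /T /K; case: ltP => Skappa.
    have dS : [disjoint S :&: S0 & S :\: S0]%SET%B.
      by apply/pred0P => i /=; rewrite !inE; case: (i \in S0); rewrite ?andbF.
    have [gamma gP] := split_at dS.
    suff: dominated g theta B (S :&: S0 :|: S :\: S0)%SET (S :&: S0)%SET
        (C * m1 ^+ #|(S :&: S0 :|: S :\: S0)%SET|) by rewrite finset.setID.
    apply: (dominated_setU dS mB _ _ gP).
      by rewrite mulr_ge0 ?exprn_ge0 ?ltW.
    by move=> i; rewrite inE => /andP[/th0].
  set U := (S :|: S0)%SET.
  have SU : S \subset U by exact: finset.subsetUl.
  have thU i : i \notin U -> tnth theta i = 0.
    by rewrite inE negb_or => /andP[_ /th0].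
  have [G [mG G0 G1 GP]] := dominated_ball SU mB thU
    (expR_gt0 (c1 * #|U|%:R)) (expR_ge0 (2 * c1 * #|U|%:R))
    (density_ge0 (g #|U|) (coord_proj U theta)) (smooth_at theta)
    (fun t => nested_at theta t SU) (fun t => rB S t Skappa).
  exists G; split => // x; apply: le_trans (GP x) _.
  apply: lee_wpmul2r => //; apply: lee_wpmul2r; first exact: model_evidence_ge0.
  rewrite lee_fin /E -[ball_rate]lnK ?posrE ?ball_rate_gt0// -expRM_natl.
  rewrite -!expRD ler_expR.
  have : #|U|%:R <= kappa + k.
    apply: (@le_trans _ _ (#|S|%:R + #|S0|%:R)); last exact: lerD.
    by rewrite -natrD ler_nat cardsU leq_subr.
  move=> /(ler_wpM2l q0); have := ler_wpM2l (ler0n R #|U|) le_q; lra.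
apply: le_trans (integral_posterior_dominated a b mB K0 dom) _.
rewrite lee_fin (bigID (fun S => kappa < #|S|%:R))/=; apply: lerD.
- rewrite (eq_bigr (fun S => C * (model_weight a b S /
      model_weight a b (S :&: S0)%SET * m1 ^+ #|S|))); last first.
    by move=> S Sk; rewrite /T /K Sk mulrCA.
  rewrite -mulr_sumr [2 * C]mulrC -mulrA ler_wpM2l ?(ltW C0)//.
  apply: sum_weight_large => //.
    by apply: le_trans kn; rewrite lerDr.
  move=> S; apply: le_trans S0k; rewrite ler_nat subset_leq_card//.
  exact: finset.subsetIr.
- rewrite (eq_bigr (fun S => model_weight a b S /
      model_weight a b (S :|: S0)%SET * E)); last first.
    by move=> S /negbTE Sk; rewrite /T /K Sk.
  apply: le_trans (sum_weight_small a1 b4 _ kn _) _; rewrite ?expR_ge0//.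
    move=> S; rewrite -leNgt => Sk.
    apply: (@le_trans _ _ (#|S|%:R + #|S0|%:R)); last exact: lerD.
    by rewrite -natrD ler_nat cardsU leq_subr.
  by rewrite -mulrA ler_wpM2l// -expRD addrA.
Qed.

End sparse_truth.

(** * Weak balls *)

Section weak_ball.
Context {R : realType}.

Lemma ge0_ler_powR_base (q x y : R) : 0 <= q -> 0 <= x -> x <= y -> x `^ q <= y `^ q.
Proof.
move=> q0 x0 xy; apply: ge0_ler_powR; rewrite ?nnegrE//.
exact: le_trans x0 xy.
Qed.

Lemma nth_sorted_gt (u : R) (l : seq R) (i : nat) : sorted >=%R l ->
  (i < count (fun x => (u < x)%R) l)%N -> u < nth 0 l i.
Proof.
elim: l i => // x l IH i xl; have [ux|xu] := ltP u x; last first.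
  rewrite (_ : count _ _ = 0%N)//; apply/eqP; rewrite -leqn0 leqNgt -has_count.
  apply/hasPn => y; rewrite inE => /predU1P[->|yl]; first by rewrite -leNgt.
  have /allP/(_ y yl)/= yx : all (>=%R x) l.
    by apply: order_path_min xl; exact: ge_trans.
  by rewrite -leNgt (le_trans yx).
rewrite /= ux add1n; case: i => [//|i]; rewrite ltnS /=.
by apply: IH; exact: path_sorted xl.
Qed.

(** If N coordinates exceed u, so does the N-th largest, and the defining inequality at rank N
    bounds N u^s. *)
Lemma weak_ball_card (s u pn : R) n (t : n.-tuple R) : 0 < s -> 0 < u ->
  weak_ball s n pn t ->
  #|[set i | u < `|tnth t i|]%SET|%:R * u `^ s <= n%:R * (pn / n%:R) `^ s.
Proof.
move=> s0 u0; rewrite /weak_ball /= => tball.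
case: n t tball => [|n] t tball.
  by rewrite mul0r (_ : #|_| = 0%N) ?mul0r//; apply: eq_card0 => -[].
set N := #|_|; case NE: N => [|N']; first by rewrite mul0r mulr_ge0// powR_ge0.
have Nn : (N' < n.+1)%N by rewrite -NE -[leqRHS]card_ord max_card.
have cN : N = count (fun x => (u < x)%R) (abs_sorted t).
  rewrite /abs_sorted count_sort count_map /N cardsE cardE size_filter.
  rewrite -[in RHS](map_tnth_enum t) count_map.
  by rewrite enumT; exact: eq_count.
rewrite -ler_pdivrMl ?ltr0Sn//; apply: le_trans tball.
rewrite ler_wpM2l ?invr_ge0//.
(* Sorted entries are numbered from 0, so the one of rank N = N'.+1 has index N'. *)
apply: (@le_trans _ _ (N'.+1%:R * nth 0 (abs_sorted t) N' `^ s)).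
  rewrite ler_wpM2l// ge0_ler_powR_base// ?(ltW s0) ?(ltW u0)// ltW//.
  apply: nth_sorted_gt; last by rewrite -cN NE.
  by apply: sort_sorted => x y; exact: ge_total.
by rewrite (le_bigmax _ _ (Ordinal Nn)).
Qed.

(** The solution of c = c 2^(- (q - s)) + 2^s, that is, the sum of the geometric series produced by
    halving. *)
Definition tail_const (s q : R) : R := 2 `^ s / (1 - 2 `^ (- (q - s))).

Lemma tail_const_gt0 (s q : R) : s < q -> 0 < tail_const s q.
Proof.
move=> sq; rewrite divr_gt0 ?powR_gt0// subr_gt0.
rewrite -[ltRHS](powRr0 2) /powR pnatr_eq0/= ltr_expR mul0r.
by rewrite pmulr_llt0 ?ln_gt0 ?ltr1n// oppr_lt0 subr_gt0.
Qed.

(* Halving tau: tau / 2 < x <= tau holds for at most A (tau / 2) `^ - s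
   indices, so that the dyadic pieces form a geometric series. *)
Lemma weak_tail_sum (I : finType) (x : I -> R) (s q A tau : R) :
  0 < s -> s < q -> 0 < tau -> (forall i, 0 <= x i) ->
  (forall u, 0 < u -> #|[set i | u < x i]%SET|%:R * u `^ s <= A) ->
  \sum_(i | x i <= tau) x i `^ q <= A * (tail_const s q * tau `^ (q - s)).
Proof.
move=> s0 sq tau0 x0 xA; have q0 : 0 < q by exact: lt_trans sq.
have A0 : 0 <= A.
  by apply: le_trans (xA 1 ltr01); rewrite mulr_ge0// powR_ge0.
set c := tail_const s q; set h := 2^-1 `^ q : R.
have h01 : `|h| < 1.
  rewrite ger0_norm ?powR_ge0// /h /powR invr_eq0 pnatr_eq0/= -[ltRHS]expR0.
  by rewrite ltr_expR lnV ?posrE// pmulr_rlt0// oppr_lt0 ln_gt0// ltr1n.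
have c0 : 0 < c by exact: tail_const_gt0.
(* After m halvings the remaining sum is bounded trivially, by its number of terms times the largest
   possible one; this remainder vanishes as m grows. *)
have halve m : forall tau, 0 < tau -> \sum_(i | x i <= tau) x i `^ q <=
    A * (c * tau `^ (q - s)) + #|I|%:R * tau `^ q * h ^+ m.
  elim: m => [|m IH] t t0.
    rewrite expr0 mulr1; apply: (@le_trans _ _ (#|I|%:R * t `^ q)).
      rewrite mulr_natl -sumr_const [leRHS](bigID (fun i => x i <= t))/= ler_wpDr//.
        by apply: sumr_ge0 => i _; exact: powR_ge0.
      by apply: ler_sum => i xt; rewrite ge0_ler_powR_base// ltW.
    by rewrite lerDr; apply: mulr_ge0 => //; apply: mulr_ge0; [exact: ltW|exact: powR_ge0].
  have t20 : 0 < t / 2 by rewrite divr_gt0.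
  rewrite (bigID (fun i => x i <= t / 2))/=.
  rewrite (eq_bigl (fun i => x i <= t / 2)); last first.
    by move=> i; apply: andb_idl => /le_trans; apply; lra.
  apply: (@le_trans _ _ (A * (c * (t / 2) `^ (q - s)) +
      #|I|%:R * (t / 2) `^ q * h ^+ m + A * (t / 2) `^ (- s) * t `^ q)).
    apply: lerD; first exact: IH.
    apply: (@le_trans _ _ (\sum_(i in [set i | t / 2 < x i]%SET) t `^ q)).
      rewrite big_mkcond [leRHS]big_mkcond/=; apply: ler_sum => i _.
      rewrite inE ltNge; case: (x i <= t / 2); rewrite ?andbF//=.
      case: ifP => [|_]; last exact: powR_ge0.
      by rewrite andbT => xt; apply: ge0_ler_powR_base => //; exact: ltW.
    rewrite sumr_const -[leLHS]mulr_natl ler_wpM2r ?powR_ge0// powRN.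
    by rewrite ler_pdivlMr ?powR_gt0// xA.
  have tqs : t `^ q = t `^ (q - s) * t `^ s.
    by rewrite -powRD ?subrK// (gt_eqF t0) implybT.
  have e1 : (t / 2) `^ q = t `^ q * h by rewrite powRM ?invr_ge0 ?ltW.
  have e2 : (t / 2) `^ (q - s) = t `^ (q - s) * 2 `^ (- (q - s)).
    rewrite powRM ?invr_ge0 ?ltW//; congr (_ * _).
    by rewrite -[2^-1]powR_inv1// -powRrM mulN1r.
  have e3 : (t / 2) `^ (- s) = t `^ (- s) * 2 `^ s.
    rewrite powRM ?invr_ge0 ?ltW//; congr (_ * _).
    by rewrite -[2^-1]powR_inv1// -powRrM mulN1r opprK.
  have e4 : t `^ (- s) * t `^ q = t `^ (q - s).
    by rewrite tqs powRN mulrCA mulVf ?mulr1// gt_eqF// powR_gt0.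
  rewrite e1 e2 e3 exprS.
  have cE : c = c * 2 `^ (- (q - s)) + 2 `^ s.
    rewrite /c /tail_const; field; rewrite gt_eqF//.
    have := tail_const_gt0 sq; rewrite /tail_const pmulr_rgt0 ?powR_gt0//.
    by rewrite invr_gt0.
  rewrite [leRHS](_ : _ = A * ((c * 2 `^ (- (q - s)) + 2 `^ s) * t `^ (q - s)) +
    #|I|%:R * t `^ q * (h * h ^+ m)); last by rewrite -cE.
  by rewrite -e4 le_eqVlt; apply/orP; left; apply/eqP; ring.
set B := A * _; apply/ler_addgt0Pr => e e0.
set F := #|I|%:R * tau `^ q.
have /cvgrPdist_le/(_ _ e0)[m _ /(_ m (leqnn m))/=] :
    geometric F h x @[x --> \oo] --> 0 by exact: cvg_geometric.
rewrite sub0r normrN => Fe; apply: le_trans (halve m _ tau0) _.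
by rewrite lerD2l; apply: le_trans (ler_norm _) Fe.
Qed.

(** Above tau, u^q = u^(q - 2) u^2 and the exponent q - 2 is negative. The price tau^q is paid once
    per coordinate, hence the need for a bounded number of them. *)
Lemma powR_le_sqr (q tau u : R) : 0 < q < 2 -> 0 < tau -> 0 <= u ->
  u `^ q <= tau `^ q + tau `^ (q - 2) * u ^+ 2.
Proof.
move=> /andP[q0 q2] tau0 u0; have [ut|tu] := leP u tau.
  by rewrite ler_wpDr ?mulr_ge0 ?powR_ge0 ?sqr_ge0// ge0_ler_powR_base// ltW.
rewrite ler_wpDl ?powR_ge0// -powR_mulrn//.
have {}u0 : 0 < u by exact: lt_trans tu.
rewrite -{1}(subrK 2 q) [X in X <= _]powRD ?(gt_eqF u0) ?implybT//.
rewrite ler_wpM2r ?powR_ge0//.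
rewrite -[q - 2]opprB !powRN lef_pV2 ?posrE ?powR_gt0//.
by apply: ge0_ler_powR_base; [rewrite subr_ge0 ltW|exact: ltW|exact: ltW].
Qed.

Lemma powRD_le4 (q u v : R) : 0 < q < 2 -> 0 <= u -> 0 <= v ->
  (u + v) `^ q <= 4 * (u `^ q + v `^ q).
Proof.
move=> /andP[q0 q2]; wlog uv : u v / u <= v.
  move=> H u0 v0; have [uv|vu] := leP u v; first exact: H.
  by rewrite addrC [X in 4 * X]addrC; apply: H => //; exact: ltW.
move=> u0 v0; apply: (@le_trans _ _ ((2 * v) `^ q)).
  by apply: ge0_ler_powR_base; [exact: ltW|exact: addr_ge0|lra].
rewrite powRM//; apply: ler_pM; rewrite ?powR_ge0//; last first.
  by rewrite lerDr powR_ge0.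
apply: (@le_trans _ _ (2 `^ 2%:R)); first by rewrite ler_powR ?ler1n// ltW.
by rewrite powR_mulrn// expr2; lra.
Qed.

(** The triangle inequality passes through [thetas]. Outside T both theta and [thetas] vanish, as T
    contains S0; inside T the squared distance takes over. The last sum is the error of the
    truncation. *)
Lemma dq_le n (S0 T : {set 'I_n}) (q tau : R) (theta theta0 thetas : n.-tuple R) :
  0 < q < 2 -> 0 < tau ->
  (forall i, tnth thetas i = if i \in S0 then tnth theta0 i else 0) ->
  S0 \subset T -> (forall i, i \notin T -> tnth theta i = 0) ->
  dq q theta theta0 <= 4 * (#|T|%:R * tau `^ q +
    tau `^ (q - 2) * sqdist_on T theta thetas +
    \sum_(i | i \notin S0) `|tnth theta0 i| `^ q).
Proof.
move=> q02 tau0 thsE S0T thT; have q0 : q != 0 by case/andP: q02 => /gt_eqF->.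
set X := #|T|%:R * _ + _.
have leX : \sum_(i < n) `|tnth theta i - tnth thetas i| `^ q <= X.
  rewrite (bigID (mem T))/= [X in _ + X]big1 ?addr0; last first.
    move=> i iT; rewrite thT// thsE ifN ?subrr ?normr0 ?powR0//.
    by apply: contra iT; exact: (fintype.subsetP S0T).
  rewrite /X mulr_natl -sumr_const /sqdist_on mulr_sumr -big_split/=.
  apply: ler_sum => i _; rewrite -[X in _ * X]real_normK ?num_real//.
  exact: powR_le_sqr.
have leY : \sum_(i < n) `|tnth thetas i - tnth theta0 i| `^ q =
    \sum_(i | i \notin S0) `|tnth theta0 i| `^ q.
  rewrite [RHS]big_mkcond/=; apply: eq_bigr => i _; rewrite thsE.
  by case: (i \in S0) => /=; rewrite ?subrr ?normr0 ?powR0// sub0r normrN.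
rewrite -leY; apply: (@le_trans _ _ (\sum_(i < n)
   4 * (`|tnth theta i - tnth thetas i| `^ q +
        `|tnth thetas i - tnth theta0 i| `^ q))).
  apply: ler_sum => i _; apply: le_trans (powRD_le4 _ _ _) => //.
  apply: ge0_ler_powR_base => //; first by case/andP: q02 => /ltW.
  by apply: le_trans (ler_normD _ _); rewrite addrA subrK.
by rewrite -mulr_sumr ler_wpM2l// big_split/= lerD2r.
Qed.

End weak_ball.

(** * Nonasymptotic bound *)

Section rates.
Context {R : realType}.
Variables (b s pn L k : R) (n : nat).
Hypotheses (b4 : expR 4 <= b) (s0 : 0 < s) (pn0 : 0 < pn) (n0 : (0 < n)%N).
Hypotheses (LE : L = ln (n%:R / pn))
  (kE : k = n%:R * (pn / n%:R) `^ s / L `^ (s / 2)).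
Hypotheses (L1 : 1 <= L) (lnbL : ln b <= s * L).

Let nR0 : 0 < n%:R :> R. Proof. by rewrite ltr0n. Qed.
Let L0 : 0 < L. Proof. exact: lt_le_trans L1. Qed.
Let b0 : 0 < b. Proof. by apply: lt_le_trans b4; exact: expR_gt0. Qed.
Let lnb0 : 0 <= ln b.
Proof. by apply: (@le_trans _ _ 4) => //; rewrite -ler_expR lnK ?posrE. Qed.

Lemma rate_gt0 : 0 < k.
Proof. by rewrite kE divr_gt0 ?mulr_gt0 ?powR_gt0 ?divr_gt0. Qed.

(** By definition n/k = (n/p_n)^s L^(s/2), so the logarithm is s L + (s/2) ln L, and 0 <= ln L <=
    L. *)
Lemma ln_rate_bounds : s * L <= ln (n%:R / k) <= 2 * s * L.
Proof.
have k0 := rate_gt0.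
have -> : ln (n%:R / k) = s * L + s / 2 * ln L.
  have -> : n%:R / k = (n%:R / pn) `^ s * L `^ (s / 2).
    have pE : pn / n%:R = (n%:R / pn) `^ (- 1).
      by rewrite powR_inv1 ?divr_ge0 ?(ltW pn0)// invf_div.
    rewrite kE pE -powRrM mulN1r powRN; field.
    by rewrite !gt_eqF ?powR_gt0 ?divr_gt0.
  by rewrite lnM ?posrE ?powR_gt0 ?divr_gt0// !ln_powR -LE.
have lnL0 : 0 <= ln L by rewrite ln_ge0.
have lnL : ln L <= L.
  by rewrite -ler_expR lnK ?posrE//; apply: le_trans (expR_ge1Dx _); lra.
apply/andP; split; first by rewrite lerDl mulr_ge0// ltW// divr_gt0.
have := ler_wpM2l (ltW s0) lnL; have := ler_wpM2l (ltW s0) lnL0; lra.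
Qed.

Lemma entropy_rateE x : 0 < x ->
  entropy b n (x * k) = x * k * (ln b + ln (n%:R / k) - ln x).
Proof.
move=> x0; have k0 := rate_gt0; rewrite /entropy; congr (_ * _).
have nk0 : 0 < n%:R / k by exact: divr_gt0.
rewrite -lnM ?posrE// -ln_div ?posrE//; last exact: mulr_gt0.
by congr ln; field; rewrite !gt_eqF.
Qed.

(** The 3 is made of one s L for ln b and two for ln(n/k). *)
Lemma entropy_rate_le x : 1 <= x -> entropy b n (x * k) <= 3 * s * x * (k * L).
Proof.
move=> x1; have x0 : 0 < x by exact: lt_le_trans x1.
have k0 := rate_gt0; have /andP[_ le2] := ln_rate_bounds.
have lnx : 0 <= ln x by rewrite ln_ge0.
rewrite entropy_rateE// [leRHS](_ : _ = x * k * (3 * s * L)); last by ring.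
have xk0 : 0 <= x * k by apply/ltW/mulr_gt0.
apply: (ler_wpM2l xk0); have := lnbL; lra.
Qed.

Lemma entropy_rate_ge x : 1 <= x -> 2 * ln x <= s * L ->
  s / 2 * x * (k * L) <= entropy b n (x * k).
Proof.
move=> x1 lnx; have x0 : 0 < x by exact: lt_le_trans x1.
have k0 := rate_gt0; have /andP[ge1 _] := ln_rate_bounds.
rewrite entropy_rateE// [leLHS](_ : _ = x * k * (s / 2 * L)); last by ring.
have xk0 : 0 <= x * k by apply/ltW/mulr_gt0.
apply: (ler_wpM2l xk0); have := lnb0; lra.
Qed.

Lemma rate_le_n x : 0 < x -> ln x <= s * L -> x * k <= n%:R.
Proof.
move=> x0 lnx; have k0 := rate_gt0; have /andP[ge1 _] := ln_rate_bounds.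
have nk0 : 0 < n%:R / k by exact: divr_gt0.
rewrite -ler_pdivlMr// -ler_ln ?posrE//.
exact: le_trans ge1.
Qed.

End rates.

Section weak_truth.
Context {R : realType}.
Variables (c1 C m1 : R) (n : nat) (g : forall k, density R k).
Hypotheses (C0 : 0 < C) (m10 : 0 < m1).
Hypothesis g_gt0 : forall (S : {set 'I_n}) (t : #|S|.-tuple R), 0 < g #|S| t.
Hypothesis g_smooth : forall (S : {set 'I_n}) (t t' : #|S|.-tuple R),
  ln (g #|S| t) - ln (g #|S| t')
    <= c1 * #|S|%:R + 64^-1 * enorm (tsub t t') ^+ 2.
Hypothesis g_nested : forall (S' S : {set 'I_n}) (t : #|S|.-tuple R),
  S' \subset S ->
  `| ln (g #|S| t) - ln (g #|S'| (coord_proj S' (embed t))) |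
    <= c1 * #|S|%:R + 64^-1 * enorm (coord_proj (S :\: S')%SET (embed t)) ^+ 2.
Hypothesis g_split : forall S2 : {set 'I_n}, exists gamma : density R #|S2|,
  forall (t2 : #|S2|.-tuple R) (S1 : {set 'I_n}), S1 \subset (~: S2)%SET ->
  (ereal_sup [set (g #|S1 :|: S2| (merge_coords t1 t2) / g #|S1| t1)%:E
             | t1 in [set: #|S1|.-tuple R]]
    <= (C * m1 ^+ (#|S1| + #|S2|) * gamma t2)%:E)%E.
Variables (a b qh s pn : R).
Hypotheses (a1 : 1 <= a) (b4 : expR 4 <= b) (m14b : m1 ^+ 4 <= b).
Hypotheses (qh0 : 0 <= qh) (le_qh : 3 * c1 + ln (@ball_rate R) <= qh).
Hypotheses (s02 : 0 < s < 2) (pn0 : 0 < pn) (n0 : (0 < n)%N).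
Variables (L k H M1 Mr : R).
Hypotheses (LE : L = ln (n%:R / pn))
  (kE : k = n%:R * (pn / n%:R) `^ s / L `^ (s / 2)).
(** All exponents are measured in units of k L. H is the decay required at the truncated truth:
    [tail_const s 2] and one unit are lost in the change of measure, and one unit must survive.
    [M1H] and [MrH] say that the large and the small models reach this decay. *)
Hypotheses (HE : tail_const s 2 + 2 <= H) (M11 : 1 <= M1).
Hypotheses (M1H : H <= s / 4 * M1 - 3 * s * (a + 1)).
Hypotheses (MrH : H <= 16^-1 * Mr - (M1 + 1) * (3 * s * (a + 1) + qh)).
Hypotheses (L1 : 1 <= L) (lnbL : ln b <= s * L) (M1L : 2 * ln (M1 + 1) <= s * L).

Let s0 : 0 < s. Proof. by case/andP: s02. Qed.
Let s2 : s < 2. Proof. by case/andP: s02. Qed.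
Let L0 : 0 < L. Proof. exact: lt_le_trans L1. Qed.
Let k0 : 0 < k. Proof. exact: (rate_gt0 pn0 n0 kE L1). Qed.

Definition big_coords (theta : n.-tuple R) : {set 'I_n} :=
  [set i | Num.sqrt L < `|tnth theta i|]%SET.

Definition restrict_big (theta : n.-tuple R) : n.-tuple R :=
  [tuple if i \in big_coords theta then tnth theta i else 0 | i < n].

Lemma powR_sqrt x : Num.sqrt L `^ x = L `^ (x / 2).
Proof. by rewrite -powR12_sqrt ?(ltW L0)// -powRrM mulrC. Qed.

Lemma card_big_coords theta : weak_ball s n pn theta ->
  #|big_coords theta|%:R <= k.
Proof.
move=> tb; rewrite kE ler_pdivlMr ?powR_gt0// -powR_sqrt.
by apply: (weak_ball_card s0 _ tb); rewrite sqrtr_gt0.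
Qed.

(** Dyadic summation at the threshold sqrt L. The case of exponent 2 prices the change of measure,
    the case of exponent q the truncation error in d_q. *)
Lemma tail_sum_small theta q : s < q -> weak_ball s n pn theta ->
  \sum_(i | i \notin big_coords theta) `|tnth theta i| `^ q <=
  tail_const s q * (k * L `^ (q / 2)).
Proof.
move=> sq tb; rewrite (eq_bigl (fun i => `|tnth theta i| <= Num.sqrt L)); last first.
  by move=> i; rewrite inE -leNgt.
have sL0 : 0 < Num.sqrt L by rewrite sqrtr_gt0.
apply: le_trans (weak_tail_sum s0 sq sL0 _ _) _.
- by move=> i; exact: normr_ge0.
- by move=> u u0; exact: weak_ball_card s0 u0 tb.
have -> : Num.sqrt L `^ (q - s) = L `^ (q / 2) / L `^ (s / 2).
  by rewrite powR_sqrt mulrBl powRB// (gt_eqF L0) implybT.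
by rewrite kE le_eqVlt; apply/orP; left; apply/eqP; ring.
Qed.

(** The bound depends on neither theta nor B, so a supremum over the ball costs nothing. *)
Lemma posterior_weak_ball_le theta (B : set (n.-tuple R)) :
  weak_ball s n pn theta -> measurable B ->
  (forall (S : {set 'I_n}) (t : #|S|.-tuple R), #|S|%:R <= M1 * k ->
    B (embed t) -> Mr * (k * L) <=
      sqdist_on (S :|: big_coords theta)%SET (embed t) (restrict_big theta)) ->
  (\int[density_prob (normal_tuple_pdf theta)]_x
     (posterior (complexity_prior a b g) x B)%:E <=
   ((2 * C + 3) * expR (- (k * L)))%:E)%E.
Proof.
move=> tb mB rB; set ths := restrict_big theta; set rho := k * L.
have [hM1L hM11 ha1 hC0] := And4 M1L M11 a1 C0.
have rho0 : 0 < rho by rewrite mulr_gt0.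
have M10 : 0 < M1 by exact: lt_le_trans M11.
have lnM1 : ln M1 <= ln (M1 + 1).
  by rewrite ler_ln ?posrE ?addr_gt0// lerDl.
have lnM10 : 0 <= ln M1 by rewrite ln_ge0.
have kn : M1 * k + k <= n%:R.
  rewrite -{2}[k]mul1r -mulrDl; apply: (rate_le_n s0 pn0 n0 LE kE L1); [lra|lra].
have ths0 i : i \notin big_coords theta -> tnth ths i = 0.
  by move=> /negbTE iS; rewrite tnth_mktuple iS.
have sparse := @posterior_sparse_le _ c1 C m1 n g C0 m10 g_gt0 g_smooth g_nested
  g_split a b a1 b4 m14b qh qh0 le_qh (big_coords theta) ths B k (M1 * k)
  (Mr * rho) mB ths0 (card_big_coords tb) (mulr_ge0 (ltW M10) (ltW k0)) kn rB.
have e1 : entropy b n k <= 3 * s * rho.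
  by have := entropy_rate_le b4 s0 pn0 n0 LE kE L1 lnbL (lexx 1); rewrite mul1r mulr1.
have e2 : s / 2 * M1 * rho <= entropy b n (M1 * k).
  by apply: (entropy_rate_ge b4 s0 pn0 n0 LE kE L1) => //; lra.
have e3 : entropy b n (M1 * k + k) <= 3 * s * (M1 + 1) * rho.
  rewrite -{2}[k]mul1r -mulrDl; apply: (entropy_rate_le b4 s0 pn0 n0 LE kE L1) => //; lra.
have krho : k <= rho by rewrite ler_peMr// ltW.
have H0 := ler_wpM2l (ltW rho0) M1H.
have H1 := ler_wpM2l (ltW rho0) MrH.
have a0 : 0 <= a + 1 by lra.
have b1 : expR (- (2^-1 * entropy b n (M1 * k)) + (a + 1) * entropy b n k) <=
    expR (- (H * rho)).
  rewrite ler_expR; have := ler_wpM2l a0 e1; lra.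
have b2 : expR ((a + 1) * entropy b n (M1 * k + k) + qh * (M1 * k + k) -
    16^-1 * (Mr * rho)) <= expR (- (H * rho)).
  rewrite ler_expR; have := ler_wpM2l a0 e3.
  have : qh * (M1 * k + k) <= qh * ((M1 + 1) * rho).
    rewrite -{2}[k]mul1r -mulrDl; apply: ler_wpM2l => //.
    by apply: ler_wpM2l => //; lra.
  lra.
have {sparse b1 b2}sparse : (\int[density_prob (normal_tuple_pdf ths)]_x
     (posterior (complexity_prior a b g) x B)%:E <=
     ((2 * C + 2) * expR (- (H * rho)))%:E)%E.
  apply: le_trans sparse _; rewrite lee_fin [leRHS]mulrDl lerD// ler_wpM2l//.
  by rewrite mulr_ge0// ltW.
set c := tail_const s 2.
have dist : \sum_(i < n) (tnth theta i - tnth ths i) ^+ 2 <= c * rho.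
  have := tail_sum_small s2 tb; rewrite divff// powRr1 ?(ltW L0)//.
  move=> h; apply: le_trans h; rewrite [leRHS]big_mkcond/=.
  apply: ler_sum => i _; rewrite tnth_mktuple; case: ifP => /= iS.
    by rewrite subrr expr0n.
  by rewrite subr0 powR_mulrn// real_normK// num_real.
(* This choice turns the second term of the change of measure into exp(- rho), and the factor lambda
   exp(- H rho) in the first is also at most exp(- rho), since H >= c + 2. *)
pose lambda := expR ((c + 1) * rho).
have lambda0 : 0 < lambda := expR_gt0 _.
apply: le_trans (integral_change_of_center theta ths lambda0
  (measurable_posterior (complexity_prior a b g) mB) _) _.
  by move=> x; rewrite posterior_ge0 posterior_le1.
apply: (@le_trans _ _ (lambda%:E * ((2 * C + 2) * expR (- (H * rho)))%:E +
    (lambda^-1 * expR (c * rho))%:E)%E).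
  apply: leeD; first by rewrite lee_wpmul2l// lee_fin ltW.
  by rewrite lee_fin ler_wpM2l ?invr_ge0 ?(ltW lambda0)// ler_expR.
rewrite -EFinM -EFinD lee_fin /lambda -expRN.
have -> : expR (- ((c + 1) * rho)) * expR (c * rho) = expR (- rho).
  by rewrite -expRD; congr expR; ring.
rewrite mulrCA -expRD.
have : expR ((c + 1) * rho - H * rho) <= expR (- rho).
  by rewrite ler_expR; have := ler_wpM2l (ltW rho0) HE; rewrite -/c; lra.
have : 0 <= 2 * C + 2 by lra.
move=> /ler_wpM2l h /h; lra.
Qed.

End weak_truth.

(** * Asymptotics *)

Section events.
Context {R : realType}.
Variable n : nat.

Lemma measurable_gt_set (c : R) (f : n.-tuple R -> R) : measurable_fun setT f ->
  measurable [set theta | c < f theta].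
Proof.
move=> mf; rewrite -[X in measurable X]setTI.
by apply: (measurable_fun_ltr (measurable_cst c) mf measurableT (Y := [set true])).
Qed.

Lemma measurable_card_support :
  measurable_fun setT (fun theta : n.-tuple R => #|coord_support theta|%:R : R).
Proof.
rewrite (_ : (fun _ => _) = fun theta : n.-tuple R =>
    \sum_(i < n) \1_(~` [set 0]) (tnth theta i)).
  apply: measurable_sum => i; apply: (measurableT_comp _ (measurable_tnth i)).
  by apply: measurable_indic; apply: measurableC; exact: measurable_set1.
apply/funext => theta; rewrite cardsE -sum1_card natr_sum big_mkcond/=.
apply: eq_bigr => i _; rewrite indicE unfold_in /=.
have [->|t0] := eqVneq (tnth theta i) 0; first by rewrite memNset//=; apply.
by rewrite mem_set//=; exact/eqP.
Qed.

Lemma measurable_dq (q : R) (theta0 : n.-tuple R) :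
  measurable_fun setT (fun theta => dq q theta theta0).
Proof.
apply: measurable_sum => i; apply: (measurableT_comp (measurable_powR q)).
apply: measurableT_comp => //; apply: measurable_funB => //.
exact: measurable_tnth.
Qed.

Lemma card_support_embed (S : {set 'I_n}) (t : #|S|.-tuple R) :
  (#|coord_support (embed t)| <= #|S|)%N.
Proof.
apply: subset_leq_card; apply/fintype.subsetP => i; rewrite inE.
by apply: contraR => /tnth_embed_out ->.
Qed.

(** The ball is nonempty, which keeps the suprema of the theorem from being [-oo]. *)
Lemma weak_ball0 (s pn : R) : s != 0 -> weak_ball s n pn [tuple 0 | _ < n].
Proof.
move=> s0; rewrite /weak_ball /=.
have nth0 i : (abs_sorted [tuple (0 : R) | _ < n])`_i = 0.
  have [ilt|] := ltnP i (size (abs_sorted [tuple (0 : R) | _ < n])); last first.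
    by move=> ?; rewrite nth_default.
  have := mem_nth 0 ilt; rewrite mem_sort => /mapP[x /tnthP[j ->] ->].
  by rewrite tnth_mktuple normr0.
rewrite (_ : \big[Num.max/0]_(_ < _) _ = 0) ?mulr0 ?powR_ge0//.
apply: big1_idem => //= [|i _]; first by rewrite maxxx.
by rewrite nth0 powR0// mulr0.
Qed.

End events.

Section asymptotics.
Context {R : realType}.

Lemma ln_inv_cvgy (p : nat -> R) : (forall n, 0 < p n) ->
  (fun n => p n / n%:R) @ \oo --> (0 : R) ->
  ln (n%:R / p n) @[n --> \oo] --> +oo.
Proof.
move=> p0 pn0; apply/cvgryPge => A.
have n0 : \forall n \near \oo, (0 < n)%N by exact: nbhs_infty_gt.
have small := (@cvgr_lt _ _ _ _ _ _ pn0 (expR (- A)) (expR_gt0 _)).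
near=> n.
have nn0 : 0 < n%:R :> R by rewrite ltr0n; near: n.
have : p n / n%:R < expR (- A) by near: n; exact: small.
rewrite -[p n / _]invf_div expRN ltf_pV2 ?posrE ?expR_gt0 ?divr_gt0//.
by move=> /ltW; rewrite -{1}[n%:R / p n]lnK ?posrE ?divr_gt0// ler_expR.
Unshelve. all: by end_near. Qed.

Lemma expR_rate_cvg0 (K delta : R) (L : nat -> R) : 0 < delta ->
  L n @[n --> \oo] --> +oo ->
  (K * expR (- (delta * L n)))%:E @[n --> \oo] --> (0 : \bar R)%E.
Proof.
move=> d0 Ly; apply: cvg_EFin; first exact: nearW.
rewrite -[0](mulr0 K); apply: cvgM; first exact: cvg_cst.
have : delta * L n @[n --> \oo] --> +oo.
  apply/cvgryPge => A.
  have /cvgryPge/(_ (delta^-1 * A)) := Ly.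
  by apply: filterS => n; rewrite ler_pdivrMl//.
by move=> dL; exact: (cvg_comp _ (fun x => expR (- x)) dL (@cvgr_expR R)).
Qed.

End asymptotics.

Theorem theorem2p7 (R : realType) (c1 C m1 : R) (C_gt0 : 0 < C)
    (m1_gt0 : 0 < m1) :
  exists a0 b0 : R, 1 <= a0 /\ expR 1 < b0 /\
  forall g : forall n k : nat, density R k,
  (forall n (S : {set 'I_n}) (t : #|S|.-tuple R), 0 < g n #|S| t) ->
  (forall n (S : {set 'I_n}),
    (\int[density_prob (g n #|S|)]_t (enorm t ^+ 2)%:E < +oo)%E) ->
  (forall n (S : {set 'I_n}) (t t' : #|S|.-tuple R),
    ln (g n #|S| t) - ln (g n #|S| t')
      <= c1 * #|S|%:R + 64^-1 * enorm (tsub t t') ^+ 2) ->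
  (forall n (S' S : {set 'I_n}) (t : #|S|.-tuple R), S' \subset S ->
    `| ln (g n #|S| t) - ln (g n #|S'| (coord_proj S' (embed t))) |
      <= c1 * #|S|%:R
         + 64^-1 * enorm (coord_proj (S :\: S')%SET (embed t)) ^+ 2) ->
  (forall n (S2 : {set 'I_n}), exists gamma : density R #|S2|,
    forall (t2 : #|S2|.-tuple R) (S1 : {set 'I_n}), S1 \subset (~: S2)%SET ->
    (ereal_sup [set (g n #|S1 :|: S2| (merge_coords t1 t2) / g n #|S1| t1)%:E
               | t1 in [set: #|S1|.-tuple R]]
      <= (C * m1 ^+ (#|S1| + #|S2|) * gamma t2)%:E)%E) ->
  forall a b : R, a0 <= a -> b0 <= b ->
  forall s q : R, 0 < s < 2 -> s < q < 2 ->
  forall p : nat -> R, (forall n, 0 < p n) ->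
  (fun n => p n / n%:R) @ \oo --> (0 : R) ->
  (exists2 delta : R, 0 < delta & \forall n \near \oo, delta <= pstar s p n) ->
  exists M0 : R, forall M : R, M0 <= M ->
  (fun n => ereal_sup
     [set (\int[density_prob (normal_tuple_pdf theta0)]_x
             (posterior (complexity_prior a b (g n)) x
                [set theta : n.-tuple R |
                  M * pstar s p n < #|coord_support theta|%:R])%:E)%E
     | theta0 in weak_ball s n (p n)]) @ \oo --> 0%E
  /\
  (fun n => ereal_sup
     [set (\int[density_prob (normal_tuple_pdf theta0)]_x
             (posterior (complexity_prior a b (g n)) x
                [set theta : n.-tuple R |
                  M * mustar s q p n < dq q theta theta0])%:E)%E
     | theta0 in weak_ball s n (p n)]) @ \oo --> 0%E.
Proof.
(* e^4 serves the entropy bounds, m1^4 the sum over large models. *)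
exists 1, (expR 4 + m1 ^+ 4); split; first exact: lexx.
split.
  apply: (@lt_le_trans _ _ (expR 4)); first by rewrite ltr_expR ltr1n.
  by rewrite lerDl exprn_ge0// ltW.
move=> g g_gt0 _ g_smooth g_nested g_split a b a1 b0b s q s02 sq2 p p_gt0 pn0.
move=> [delta delta0 delta_k].
have [s0 s2] := andP s02; have [sq q2] := andP sq2.
have q02 : 0 < q < 2 by rewrite (lt_trans s0 sq).
have b4 : expR 4 <= b by apply: le_trans b0b; rewrite lerDl exprn_ge0// ltW.
have m14b : m1 ^+ 4 <= b by apply: le_trans b0b; rewrite lerDr expR_ge0.
pose qh := `|3 * c1 + ln (@ball_rate R)|.
have qh0 : 0 <= qh by exact: normr_ge0.
have le_qh : 3 * c1 + ln (@ball_rate R) <= qh by exact: ler_norm.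
pose c2 := tail_const s 2; pose cq := tail_const s q.
have c20 : 0 < c2 by exact: tail_const_gt0.
have cq0 : 0 < cq by exact: tail_const_gt0.
pose H := c2 + 2.
(* [M1] and then [Mr] solve the conditions [M1H] and [MrH] with equality. *)
pose M1 := 4 / s * (3 * s * (a + 1) + H).
pose Mr := 16 * (H + (M1 + 1) * (3 * s * (a + 1) + qh)).
have sa0 : 0 <= 3 * s * (a + 1).
  by rewrite !mulr_ge0 ?(ltW s0)//; lra.
have M11 : 1 <= M1.
  have : 1 <= 4 / s by rewrite ler_pdivlMr// mul1r; lra.
  by rewrite /M1 /H => h; nra.
have M1H : H <= s / 4 * M1 - 3 * s * (a + 1).
  rewrite /M1 le_eqVlt; apply/orP; left; apply/eqP; field.
  by rewrite gt_eqF.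
have Mr0 : 0 <= Mr.
  rewrite /Mr /H mulr_ge0// addr_ge0 ?mulr_ge0//; lra.
have MrH : H <= 16^-1 * Mr - (M1 + 1) * (3 * s * (a + 1) + qh).
  by rewrite /Mr le_eqVlt; apply/orP; left; apply/eqP; field.
pose L n := ln (n%:R / p n); pose k n := pstar s p n.
have Ly : L n @[n --> \oo] --> +oo by exact: ln_inv_cvgy.
(* Beyond this value L exceeds 1 and s L exceeds both ln b and 2 ln (M1 + 1). *)
pose Lmin := 1 + `|ln b| / s + `|2 * ln (M1 + 1)| / s.
(* Common to both conclusions; B may depend on the truth because the d_q event is centered at it. *)
have key (B : forall n, n.-tuple R -> set (n.-tuple R)) :
    (forall n theta0, measurable (B n theta0)) ->
    (forall n theta0, (0 < n)%N -> 1 <= L n -> 0 < k n ->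
      weak_ball s n (p n) theta0 ->
      forall (S : {set 'I_n}) (t : #|S|.-tuple R), #|S|%:R <= M1 * k n ->
      B n theta0 (embed t) -> Mr * (k n * L n) <=
        sqdist_on (S :|: big_coords (L n) theta0)%SET (embed t)
          (restrict_big (L n) theta0)) ->
    (fun n => ereal_sup
       [set (\int[density_prob (normal_tuple_pdf theta0)]_x
          (posterior (complexity_prior a b (g n)) x (B n theta0))%:E)%E
       | theta0 in weak_ball s n (p n)]) @ \oo --> 0%E.
  move=> mB farB.
  (* The lower bound delta on [pstar] enters here: exp(- k L) <= exp(- delta L). *)
  have upper := expR_rate_cvg0 (2 * C + 3) delta0 Ly.
  apply: (squeeze_cvge _ (cvg_cst 0%E) upper).
  have npos : \forall n \near \oo, (0 < n)%N by exact: nbhs_infty_gt.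
  have Lbig : \forall n \near \oo, Lmin <= L n by move/cvgryPge : Ly; exact.
  near=> n.
  have n0 : (0 < n)%N by near: n.
  have LnL : Lmin <= L n by near: n; exact: Lbig.
  have dk : delta <= k n by near: n; exact: delta_k.
  have k0 : 0 < k n by exact: lt_le_trans dk.
  have h1 : 0 <= `|ln b| / s by rewrite divr_ge0// ltW.
  have h2 : 0 <= `|2 * ln (M1 + 1)| / s by rewrite divr_ge0// ltW.
  have L1 : 1 <= L n by apply: le_trans LnL; rewrite /Lmin; lra.
  have lnbL : ln b <= s * L n.
    apply: le_trans (ler_norm _) _; rewrite [s * _]mulrC -ler_pdivrMr//.
    by apply: le_trans LnL; rewrite /Lmin; lra.
  have M1L : 2 * ln (M1 + 1) <= s * L n.
    apply: le_trans (ler_norm _) _; rewrite [s * _]mulrC -ler_pdivrMr//.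
    by apply: le_trans LnL; rewrite /Lmin; lra.
  apply/andP; split.
    have s_neq0 : s != 0 by rewrite gt_eqF.
    pose z : n.-tuple R := [tuple 0 | _ < n].
    have z_ball : weak_ball s n (p n) z by exact: weak_ball0.
    have z_ge0 : (0 <= \int[density_prob (normal_tuple_pdf z)]_x
       (posterior (complexity_prior a b (g n)) x (B n z))%:E)%E.
      by apply: integral_ge0 => x _; rewrite lee_fin posterior_ge0.
    by apply: le_trans z_ge0 _; apply: ereal_sup_ubound; exists z.
  apply: ge_ereal_sup => _ [theta0 tb <-].
  apply: le_trans (posterior_weak_ball_le C_gt0 m1_gt0 (g_gt0 n) (g_smooth n)
    (g_nested n) (g_split n) a1 b4 m14b qh0 le_qh s02 (p_gt0 n) n0
    (erefl (L n)) (erefl (k n)) (lexx H) M11 M1H MrH L1 lnbL M1L tb (mB _ _) _) _.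
    exact: farB.
  rewrite lee_fin ler_wpM2l//; first by have := C_gt0; lra.
  rewrite ler_expR lerN2 ler_wpM2r//.
  exact: le_trans ler01 L1.
(* The 4 comes from [dq_le], M1 + 1 from the number of coordinates in play, cq from the truncation
   error; Mr is what remains for the squared distance. *)
exists (4 * (M1 + 1 + cq + Mr)) => M M0M; split.
  have M1M : M1 <= M by apply: le_trans M0M; lra.
  apply: (key (fun n theta0 => [set theta | M * k n < #|coord_support theta|%:R])).
    by move=> n _; apply: measurable_gt_set; exact: measurable_card_support.
  (* A vector of a model of size at most M1 k has too small a support, so the separation condition
     is vacuous. *)
  move=> n theta0 n0 L1 k0 tb S t SM /= MS; exfalso.
  have : M * k n < M1 * k n.
    apply: (lt_le_trans MS); apply: le_trans SM.
    by rewrite ler_nat card_support_embed.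
  by rewrite ltr_pM2r// ltNge M1M.
apply: (key (fun n theta0 => [set theta | M * mustar s q p n < dq q theta theta0])).
  by move=> n theta0; apply: measurable_gt_set; exact: measurable_dq.
move=> n theta0 n0 L1 k0 tb S t SM /= farS.
have L0 : 0 < L n by exact: lt_le_trans L1.
have tau0 : 0 < Num.sqrt (L n) by rewrite sqrtr_gt0.
set D := sqdist_on _ _ _; set tq := Num.sqrt (L n) `^ q.
have tq0 : 0 < tq by exact: powR_gt0.
have tq2 : Num.sqrt (L n) `^ (q - 2) = tq / L n.
  by rewrite powRB ?(gt_eqF tau0) ?implybT// powR_mulrn ?sqrtr_ge0// sqr_sqrtr// ltW.
have tqE : tq = L n `^ (q / 2) by rewrite /tq -powR12_sqrt ?(ltW L0)// -powRrM mulrC.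
have muE : mustar s q p n = k n * tq.
  rewrite tqE /mustar /k /pstar -/(L n) mulrBl powRB ?(gt_eqF L0) ?implybT//.
  by rewrite -!mulrA; congr (_ * (_ * _)); rewrite mulrC.
have big_k := card_big_coords s02 (erefl (k n)) L1 tb.
have tail := tail_sum_small s02 (erefl (k n)) L1 sq tb.
have thsE i : tnth (restrict_big (L n) theta0) i =
    if i \in big_coords (L n) theta0 then tnth theta0 i else 0.
  by rewrite tnth_mktuple.
have out i : i \notin (S :|: big_coords (L n) theta0)%SET -> tnth (embed t) i = 0.
  by rewrite inE negb_or => /andP[iS _]; exact: tnth_embed_out.
have dqle := dq_le q02 tau0 thsE (finset.subsetUr S _) out.
rewrite -/D -/tq tq2 in dqle.
have Uk : #|(S :|: big_coords (L n) theta0)%SET|%:R <= (M1 + 1) * k n.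
  apply: (@le_trans _ _ (#|S|%:R + #|big_coords (L n) theta0|%:R)).
    by rewrite -natrD ler_nat cardsU leq_subr.
  by rewrite mulrDl mul1r lerD.
have Uk' := ler_wpM2r (ltW tq0) Uk.
have ktq0 : 0 < k n * tq by rewrite mulr_gt0.
have far : 4 * (M1 + 1 + cq + Mr) * (k n * tq) < dq q (embed t) theta0.
  by apply: le_lt_trans farS; rewrite muE ler_wpM2r// ltW.
have {}tail : \sum_(i | i \notin big_coords (L n) theta0) `|tnth theta0 i| `^ q <=
    cq * (k n * tq) by rewrite tqE.
(* In [dq_le] the first and last terms use up M1 + 1 and cq, so the middle one must account for
   Mr. *)
have : Mr * (k n * tq) <= tq / L n * D.
  move: far dqle; set X := dq _ _ _; set Y := \sum_(i | _) _ in tail *.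
  set U := _%:R * tq in Uk' *; lra.
rewrite [leLHS](_ : _ = tq / L n * (Mr * (k n * L n))); last first.
  by field; rewrite gt_eqF.
by rewrite ler_pM2l// divr_gt0.
Unshelve. all: by end_near. Qed.
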